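(* Let $f:\mathbb{R}^{n\times n}\to\mathbb{R}$ be convex, differentiable, symmetric, $M$-smooth and $(m,r)$-restricted strongly convex, with $\kappa=M/m$. Let $X^\star$ be a minimizer of $f$ over $\mathbb{S}^n_+$ with $r\le\mathrm{rank}(X^\star)$, let $X^\star_r$ be its best rank-$r$ approximation and $U^\star_r\in\mathbb{R}^{n\times r}$ with $X^\star_r=U^\star_r(U^\star_r)^\top$. Set $\rho'=\frac{1}{100\kappa}\frac{\sigma_r(X^\star)}{\sigma_1(X^\star)}$. Assume: (A2) $U^0\in\mathbb{R}^{n\times r}$ satisfies $\mathrm{Dist}(U^0,U^\star_r)\le\rho'\sigma_r(U^\star_r)$; (A3) $\|X^\star-X^\star_r\|_F\le \frac{1}{200\kappa^{1.5}}\frac{\sigma_r(X^\star)}{\sigma_1(X^\star)}\sigma_r(X^\star)$. Let $X^0=U^0(U^0)^\top$ and $\eta=\frac{1}{16(M\|X^0\|_2+\|\nabla f(X^0)\|_2)}$. Let $U\in\mathbb{R}^{n\times r}$ satisfy $\mathrm{Dist}(U,U^\star_r)\le\rho'\sigma_r(U^\star_r)$, let $X=UU^\top$ and $U^+=U-\eta\nabla f(X)U$. Then $$\mathrm{Dist}(U^+,U^\star_r)^2\le\alpha\,\mathrm{Dist}(U,U^\star_r)^2+\beta\,\|X^\star-X^\star_r\|_F^2,$$ where $\alpha=1-\frac{m\,\sigma_r(X^\star)}{64(M\|X^\star\|_2+\|\nabla f(X^\star)\|_2)}$ and $\beta=\frac{M}{28(M\|X^\star\|_2+\|\nabla f(X^\star)\|_2)}$.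 Furthermore, $\mathrm{Dist}(U^+,U^\star_r)\le\rho'\sigma_r(U^\star_r)$.
   Context: $\mathbb{S}^n_+$ is the cone of $n\times n$ positive semidefinite matrices. For a matrix $A$, $\sigma_i(A)$ is its $i$-th largest singular value, $\|A\|_2=\sigma_1(A)$ and $\|A\|_F$ is the Frobenius norm; $\langle A,B\rangle=\mathrm{tr}(A^\top B)$. For $U,V\in\mathbb{R}^{n\times r}$, $\mathrm{Dist}(U,V)=\min_{R\in\mathcal{O}_r}\|U-VR\|_F$, where $\mathcal{O}_r$ is the set of $r\times r$ orthogonal matrices. $f$ symmetric means $f(X)=f(X^\top)$. $f$ is $M$-smooth if $\|\nabla f(X)-\nabla f(Y)\|_F\le M\|X-Y\|_F$ for all $X,Y\in\mathbb{S}^n_+$. $f$ is $(m,r)$-restricted strongly convex if $f(Y)\ge f(X)+\langle\nabla f(X),Y-X\rangle+\frac m2\|Y-X\|_F^2$ for all $X,Y\in\mathbb{S}^n_+$ of rank at most $r$. The best rank-$r$ approximation of a PSD matrix is given by its truncated eigenvalue decomposition. *)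

(* Defs.v *)
From Stdlib Require Import Reals ClassicalEpsilon.
From mathcomp Require Import all_boot all_algebra.
Set Implicit Arguments. Unset Strict Implicit. Unset Printing Implicit Defensive.

Open Scope R_scope.

Definition rsum (n : nat) (F : 'I_n -> R) : R := \big[Rplus/0]_(i < n) F i.

Definition mmul {m p q : nat} (A : 'M[R]_(m, p)) (B : 'M[R]_(p, q)) : 'M[R]_(m, q) :=
  \matrix_(i, j) rsum (fun k => A i k * B k j).
Definition madd {m p : nat} (A B : 'M[R]_(m, p)) : 'M[R]_(m, p) :=
  \matrix_(i, j) (A i j + B i j).
Definition msub {m p : nat} (A B : 'M[R]_(m, p)) : 'M[R]_(m, p) :=
  \matrix_(i, j) (A i j - B i j).
Definition mscale {m p : nat} (c : R) (A : 'M[R]_(m, p)) : 'M[R]_(m, p) :=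
  \matrix_(i, j) (c * A i j).
Definition mid (k : nat) : 'M[R]_k := \matrix_(i, j) (if i == j then 1 else 0).

Definition minner {m p : nat} (A B : 'M[R]_(m, p)) : R :=
  rsum (fun i => rsum (fun j => A i j * B i j)).
Definition frob {m p : nat} (A : 'M[R]_(m, p)) : R := sqrt (minner A A).

Definition orthogonal {k : nat} (Q : 'M[R]_k) : Prop := mmul (trmx Q) Q = mid k.

Definition rdiag (m p : nat) (s : nat -> R) : 'M[R]_(m, p) :=
  \matrix_(i, j) (if (i : nat) == (j : nat) then s i.+1 else 0).

(* s 1 >= s 2 >= ... >= s (min m p) >= 0 are the singular values of A
   (via an SVD A = P Sigma Q^T); s is normalised to 0 outside 1..min m p *)
Definition is_svals {m p : nat} (A : 'M[R]_(m, p)) (s : nat -> R) : Prop :=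
  (forall i, (0 < i <= minn m p)%N -> 0 <= s i) /\
  (forall i j, (0 < i <= j)%N -> (j <= minn m p)%N -> s j <= s i) /\
  (forall i, ((i == 0)%N || (minn m p < i)%N) -> s i = 0) /\
  exists (P : 'M[R]_m) (Q : 'M[R]_p),
    orthogonal P /\ orthogonal Q /\ A = mmul (mmul P (rdiag m p s)) (trmx Q).

(* sigma_i(A), i-th largest singular value (1-indexed) *)
Definition singval {m p : nat} (A : 'M[R]_(m, p)) (i : nat) : R :=
  epsilon (inhabits (fun _ : nat => 0)) (is_svals A) i.

Definition snorm {m p : nat} (A : 'M[R]_(m, p)) : R := singval A 1.

Definition Dist {n r : nat} (U V : 'M[R]_(n, r)) : R :=
  epsilon (inhabits 0) (fun d =>
    (exists Q : 'M[R]_r, orthogonal Q /\ d = frob (msub U (mmul V Q))) /\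
    (forall Q : 'M[R]_r, orthogonal Q -> d <= frob (msub U (mmul V Q)))).

Definition is_psd {n : nat} (X : 'M[R]_n) : Prop :=
  trmx X = X /\
  forall v : 'I_n -> R, 0 <= rsum (fun i => rsum (fun j => v i * X i j * v j)).

Definition cols_indep {m p k : nat} (A : 'M[R]_(m, p)) (c : 'I_k -> 'I_p) : Prop :=
  forall a : 'I_k -> R,
    (forall i, rsum (fun j => a j * A i (c j)) = 0) -> forall j, a j = 0.

Definition rank_ge {m p : nat} (A : 'M[R]_(m, p)) (k : nat) : Prop :=
  exists c : 'I_k -> 'I_p, cols_indep A c.
Definition rank_le {m p : nat} (A : 'M[R]_(m, p)) (r : nat) : Prop :=
  forall k, rank_ge A k -> (k <= r)%N.

Definition convex_fun {n : nat} (f : 'M[R]_n -> R) : Prop :=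
  forall X Y t, 0 <= t <= 1 ->
    f (madd (mscale t X) (mscale (1 - t) Y)) <= t * f X + (1 - t) * f Y.

Definition has_gradient {n : nat} (f : 'M[R]_n -> R) (gradf : 'M[R]_n -> 'M[R]_n) : Prop :=
  forall X eps, 0 < eps -> exists delta, 0 < delta /\
    forall H, frob H < delta ->
      Rabs (f (madd X H) - f X - minner (gradf X) H) <= eps * frob H.

Definition symmetric_fun {n : nat} (f : 'M[R]_n -> R) : Prop :=
  forall X, f X = f (trmx X).

Definition smooth {n : nat} (gradf : 'M[R]_n -> 'M[R]_n) (M : R) : Prop :=
  forall X Y, is_psd X -> is_psd Y ->
    frob (msub (gradf X) (gradf Y)) <= M * frob (msub X Y).

Definition restricted_strongly_convex {n : nat} (f : 'M[R]_n -> R)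
    (gradf : 'M[R]_n -> 'M[R]_n) (m : R) (r : nat) : Prop :=
  forall X Y, is_psd X -> is_psd Y -> rank_le X r -> rank_le Y r ->
    f Y >= f X + minner (gradf X) (msub Y X) + m / 2 * frob (msub Y X) ^ 2.

(* Xr is a best rank-r approximation of the PSD matrix X, given by its
   truncated eigenvalue decomposition X = V diag(lam) V^T,
   lam 1 >= ... >= lam n >= 0 *)
Definition best_rank_approx {n : nat} (X : 'M[R]_n) (r : nat) (Xr : 'M[R]_n) : Prop :=
  exists (V : 'M[R]_n) (lam : nat -> R),
    orthogonal V /\
    (forall i, (0 < i <= n)%N -> 0 <= lam i) /\
    (forall i j, (0 < i <= j)%N -> (j <= n)%N -> lam j <= lam i) /\
    X = mmul (mmul V (rdiag n n lam)) (trmx V) /\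
    Xr = mmul (mmul V (rdiag n n (fun i => if (i <= r)%N then lam i else 0))) (trmx V).

(* Main.v *)
Require Import Defs.
From Stdlib Require Import Reals Lra Psatz ClassicalEpsilon FunctionalExtensionality.
From mathcomp Require Import all_boot all_order all_fingroup all_algebra.
From mathcomp Require Import Rstruct.
From mathcomp Require boolp classical_sets reals topology normedtype derive ring.
Import Order.TTheory GRing.Theory Num.Theory.
Set Implicit Arguments. Unset Strict Implicit. Unset Printing Implicit Defensive.

(* Write [U = V + D], where [V] is the rotation of [Usr] closest to [U]. First-order
   optimality of the rotation makes [U^T V] symmetric; hence in
   [X - Xsr = V D^T + D V^T + D D^T] the cross term [<V D^T, D V^T> = |D^T V|^2] is
   nonnegative and [|X - Xsr| >= (sqrt 2 - 1/100) sigma_r |D|].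
   With [G = gradf X], expand [|D - eta G U|^2], where
   [2 <G U, D> = <G, X - Xsr> + <G, D D^T>]. Restricted strong convexity bounds the
   first term below by [f X - f Xsr + m/2 |X - Xsr|^2]; here
   [f X - eta |G U|^2 >= f X^+ >= f Xs] by the descent inequality, and
   [f Xsr <= f Xs + M/2 |Xs - Xsr|^2] by smoothness and optimality of [Xs]. In the
   second term [<gradf Xs, D D^T> >= 0], because [Xs] is optimal on the cone, so only
   [|gradf X - gradf Xs| |D|^2] is lost, and this is a small multiple of
   [m sigma_r(Xs) |D|^2]. *)

Open Scope ring_scope.
Open Scope R_scope.

(** * Existence of singular value decompositions *)

(** [singval] and [Dist] are chosen by [epsilon], so nothing can be read off them before a singular
    value decomposition and a closest rotation are known to exist. Both come from maximising a trace
    over the compact set of pairs of orthogonal matrices, and both yield their first-order condition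
    through the same symmetry statement. The obstacle is that [Xs] may have rank above [r], where
    restricted strong convexity says nothing, and that its gradient need not vanish on the cone.
    This is why [Xsr] serves as the reference point, at the price of a term in [|Xs - Xsr|^2]. The
    radius is tuned so that [M * rho * sigma_1(Xs) = m * sigma_r(Xs) / 100]: inside the ball the
    gradient stays within about 2.5 percent of [m * sigma_r(Xs)] of its value at [Xs]. The same
    estimate makes the step size, fixed once at [X0], comparable with the quantities at [Xs]. The
    power 1.5 of [kappa] turns [M |Xs - Xsr|^2] into a multiple of [m], which keeps the next iterate
    in the ball. *)

Section Svd.
Import boolp classical_sets reals topology normedtype derive.
Import numFieldNormedType.Exports.
Import mathcomp.algebra_tactics.ring.
Local Open Scope ring_scope.
Local Open Scope classical_set_scope.

(** Heine-Borel and the extreme value theorem; a pair is flattened into one row vector so that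
    bounded closed sets are compact. Serves twice: with a weight matrix [C] for the singular value
    decomposition, and with [C = 1] for the closest rotation. *)
Lemma orthogonal_pair_max (K : realType) (m p : nat) (A C : 'M[K]_(m, p)) :
  exists P Q, [/\ P^T *m P = 1%:M, Q^T *m Q = 1%:M &
    forall P' Q', P'^T *m P' = 1%:M -> Q'^T *m Q' = 1%:M ->
      \tr (C^T *m (P'^T *m A *m Q')) <= \tr (C^T *m (P^T *m A *m Q))].
Proof.
pose N := (m * m + p * p)%N.
pose Pm (v : 'rV[K]_N) : 'M[K]_m := vec_mx (lsubmx v).
pose Qm (v : 'rV[K]_N) : 'M[K]_p := vec_mx (rsubmx v).
have cP i j : continuous (fun v => Pm v i j).
  by under eq_fun do rewrite !mxE; exact: coord_continuous.
have cQ i j : continuous (fun v => Qm v i j).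
  by under eq_fun do rewrite !mxE; exact: coord_continuous.
have csum (I : finType) (F : I -> 'rV[K]_N -> K) :
    (forall i, continuous (F i)) -> continuous (fun v => \sum_i F i v).
  by move=> cF; apply: continuous_big => //; exact: add_continuous.
have cmul (f g : 'rV[K]_N -> K) : continuous f -> continuous g ->
    continuous (fun v => f v * g v).
  by move=> cf cg v; apply: continuousM; [exact: cf|exact: cg].
have csqr k (S : 'rV[K]_N -> 'M[K]_k) :
    (forall i j, continuous (fun v => S v i j)) ->
    forall i j, continuous (fun v => ((S v)^T *m S v) i j).
  move=> cS i j; under eq_fun do rewrite mxE.
  apply: (csum) => l; under eq_fun do rewrite mxE.
  exact: cmul.
have clsq k (S : 'rV[K]_N -> 'M[K]_k) :
    (forall i j, continuous (fun v => S v i j)) ->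
    closed [set v | (S v)^T *m S v = 1%:M].
  move=> cS.
  rewrite (_ : mkset _ = \bigcap_(ij in [set: 'I_k * 'I_k])
    (fun v => ((S v)^T *m S v) ij.1 ij.2) @^-1`
      [set x | x = (1%:M : 'M[K]_k) ij.1 ij.2]).
    apply: closed_bigI => ij _; apply: preimage_closed; first by move=> v _; exact: (csqr _ _ cS).
    exact: closed_eq.
  apply/seteqP; split => v; first by rewrite /= => vS ij _ /=; rewrite vS.
  by move=> H; apply/matrixP => i j; exact: (H (i, j) I).
(* The square of an entry is one summand of a diagonal entry of [S^T *m S]. *)
have bnd k (S : 'M[K]_k) i j : S^T *m S = 1%:M -> `|S i j| <= 1.
  move=> /matrixP/(_ j j); rewrite !mxE eqxx /= (bigD1 i) //= mxE => e.
  rewrite -(@expr_le1 _ 2) // -normrX ger0_norm ?sqr_ge0 // -[leRHS]e -expr2 lerDl.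
  apply: sumr_ge0 => l _.
  by rewrite mxE -expr2 sqr_ge0.
pose D := [set v | (Pm v)^T *m Pm v = 1%:M] `&` [set v | (Qm v)^T *m Qm v = 1%:M].
have cD : compact D.
  apply: bounded_closed_compact; last by apply: closedI; exact: clsq.
  exists 1; split => // x x1 v [/= vP vQ].
  rewrite [leLHS]mx_normrE; apply: bigmax_le.
    by rewrite ltW // (lt_trans _ x1).
  move=> [a b] _ /=; apply: (le_trans _ (ltW x1)).
  have -> : v a b = row_mx (mxvec (Pm v)) (mxvec (Qm v)) a b.
    by rewrite !vec_mxK hsubmxK.
  rewrite ord1 mxE; case: (fintype.split b) => c; case/mxvec_indexP: c => i j;
    by rewrite mxvecE; exact: bnd.
have emb P Q : P^T *m P = 1%:M -> Q^T *m Q = 1%:M ->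
    exists2 v, v \in D & (Pm v = P) /\ (Qm v = Q).
  move=> oP oQ; have e1 : Pm (row_mx (mxvec P) (mxvec Q)) = P.
    by rewrite /Pm row_mxKl mxvecK.
  have e2 : Qm (row_mx (mxvec P) (mxvec Q)) = Q by rewrite /Qm row_mxKr mxvecK.
  exists (row_mx (mxvec P) (mxvec Q)) => //.
  by rewrite inE; split; rewrite /= ?e1 ?e2.
pose f v := \tr (C^T *m ((Pm v)^T *m A *m Qm v)).
have cf : continuous f.
  rewrite /f /mxtrace; apply: (csum) => i; under eq_fun do rewrite mxE.
  apply: (csum) => j; apply: (cmul); first exact: cst_continuous.
  under eq_fun do rewrite mxE; apply: (csum) => k.
  apply: (cmul) => //; under eq_fun do rewrite mxE.
  apply: (csum) => l; apply: (cmul); last exact: cst_continuous.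
  by under eq_fun do rewrite mxE; exact: cP.
have [||c cD' cmax] := @compact_EVT_max _ _ f D _ cD.
- have o1 k : (1%:M : 'M[K]_k)^T *m 1%:M = 1%:M by rewrite trmx1 mulmx1.
  by have [v /set_mem vD _] := emb 1%:M 1%:M (o1 _) (o1 _); exists v.
- exact: continuous_subspaceT.
move: (set_mem cD') => [/= cP' cQ'].
exists (Pm c), (Qm c); split => // P' Q' oP oQ.
by have [v vD [<- <-]] := emb _ _ oP oQ; exact: cmax.
Qed.

Lemma trace_delta_mul (K : comNzRingType) m p (A : 'M[K]_(m, p)) i j :
  \tr (delta_mx i j *m A) = A j i.
Proof.
rewrite /mxtrace (bigD1 i) //= big1 ?addr0.
  rewrite mxE (bigD1 j) //= big1 ?addr0 => [|k kj]; rewrite mxE ?eqxx ?mul1r //.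
  by rewrite (negPf kj) andbF mul0r.
by move=> k ki; rewrite mxE big1 // => l _; rewrite mxE (negPf ki) mul0r.
Qed.

(* First-order optimality along plane rotations, with the rational
   parametrisation cos = (1-t^2)/(1+t^2), sin = 2t/(1+t^2). *)
Lemma trace_max_sym (K : realFieldType) m (S : 'M[K]_m) :
  (forall G, G^T *m G = 1%:M -> \tr (G *m S) <= \tr S) -> S^T = S.
Proof.
move=> maxS; apply/matrixP => i j; rewrite mxE.
have [->//|ij] := eqVneq i j.
(* [E] projects onto the coordinate plane of [i] and [j] and [N] is a quarter turn in it, so [G c s]
   below is a plane rotation once [c^2 + s^2 = 1]. *)
pose E : 'M[K]_m := delta_mx i i + delta_mx j j.
pose N : 'M[K]_m := delta_mx i j - delta_mx j i.
have dd := @mul_delta_mx_cond K m m m.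
have ji : (j == i) = false by rewrite eq_sym (negPf ij).
have EE : E *m E = E.
  by rewrite /E mulmxDl !mulmxDr !dd !eqxx (negPf ij) ji !mulr0n !mulr1n addr0 add0r.
have EN : E *m N = N.
  rewrite /E /N mulmxDl !mulmxBr !dd !eqxx (negPf ij) ji !mulr0n !mulr1n.
  by rewrite subr0 sub0r.
have NE : N *m E = N.
  rewrite /E /N mulmxBl !mulmxDr !dd !eqxx (negPf ij) ji !mulr0n !mulr1n.
  by rewrite addr0 add0r.
have NN : N *m N = - E.
  rewrite /E /N mulmxBl !mulmxBr !dd !eqxx (negPf ij) ji !mulr0n !mulr1n.
  by rewrite subr0 sub0r opprD addrC.
have Et : E^T = E by rewrite /E linearD /= !trmx_delta.
have Nt : N^T = - N by rewrite /N linearB /= !trmx_delta opprB.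
pose G (c s : K) := 1%:M + (c - 1) *: E + s *: N.
have Gt c s : (G c s)^T = G c (- s).
  by rewrite /G linearD /= linearD /= !linearZ /= trmx1 Et Nt scaleNr scalerN.
have oG c s : c ^+ 2 = 1 - s ^+ 2 -> (G c s)^T *m G c s = 1%:M.
  move=> cs; rewrite Gt /G.
  rewrite !(mulmxDl, mulmxDr) -!scalemxAl -!scalemxAr EE EN NE NN !mul1mx !mulmx1.
  apply/matrixP => a b; move: (E) (N) => E' N'; rewrite !mxE; move: (_ *+ _) => d.
  ring: cs.
have trG c s : \tr (G c s *m S) =
    \tr S + (c - 1) * (S i i + S j j) + s * (S j i - S i j).
  rewrite /G mulmxDl mulmxDl mul1mx linearD /= linearD /= -!scalemxAl !linearZ /=.
  by rewrite /E /N mulmxDl mulmxBl linearD linearB /= !trace_delta_mul.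
set a := S i i + S j j in trG; set b := S j i - S i j in trG.
have key t : t * b <= t ^+ 2 * a.
  have t1 : 0 < 1 + t ^+ 2 by rewrite ltr_pwDl // sqr_ge0.
  have t10 : 1 + t ^+ 2 != 0 by rewrite gt_eqF.
  have /maxS : (G ((1 - t ^+ 2) / (1 + t ^+ 2)) (2 * t / (1 + t ^+ 2)))^T *m
      G ((1 - t ^+ 2) / (1 + t ^+ 2)) (2 * t / (1 + t ^+ 2)) = 1%:M.
    by apply: oG; field.
  rewrite trG -addrA gerDl.
  have -> : ((1 - t ^+ 2) / (1 + t ^+ 2) - 1) * a + 2 * t / (1 + t ^+ 2) * b =
      2 * (t * b - t ^+ 2 * a) / (1 + t ^+ 2) by field.
  by rewrite pmulr_lle0 ?invr_gt0 // pmulr_rle0 // subr_le0.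
have a1 : 0 < `|a| + 1 by rewrite ltr_wpDl.
(* [t * b <= t^2 * a] for all [t] forces [b = 0]: this [t] makes the left side a positive multiple
   of [b^2], and the right side is the same multiple times [a / (|a| + 1) < 1]. *)
have := key (b / (`|a| + 1)).
have -> : b / (`|a| + 1) * b = b ^+ 2 / (`|a| + 1) by field; rewrite gt_eqF.
have -> : (b / (`|a| + 1)) ^+ 2 * a = b ^+ 2 / (`|a| + 1) * (a / (`|a| + 1)).
  by field; rewrite gt_eqF.
rewrite -subr_le0 -{1}[b ^+ 2 / _]mulr1 -mulrBr.
have a2 : 0 < 1 - a / (`|a| + 1).
  by rewrite subr_gt0 ltr_pdivrMr // mul1r ltr_pwDr // ler_norm.
rewrite pmulr_lle0 // pmulr_lle0 ?invr_gt0 // => b2.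
have : b ^+ 2 == 0 by rewrite eq_le b2 sqr_ge0.
by rewrite sqrf_eq0 subr_eq0 => /eqP.
Qed.

Lemma orthogonal_mul (K : comUnitRingType) m (P Q : 'M[K]_m) :
  P^T *m P = 1%:M -> Q^T *m Q = 1%:M -> (P *m Q)^T *m (P *m Q) = 1%:M.
Proof. by move=> oP oQ; rewrite trmx_mul mulmxA -(mulmxA Q^T) oP mulmx1. Qed.

Lemma orthogonal_tr (K : comUnitRingType) m (P : 'M[K]_m) :
  P^T *m P = 1%:M -> P *m P^T = 1%:M.
Proof. exact: mulmx1C. Qed.

(* The weights [minn m p - i] are distinct on the diagonal, so a maximiser of
   the weighted trace of [P^T A Q] over orthogonal [P, Q] diagonalises [A]. *)
Lemma svd_exists (K : realType) m p (A : 'M[K]_(m, p)) :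
  exists (P : 'M[K]_m) (Q : 'M[K]_p) (s : nat -> K),
  [/\ P^T *m P = 1%:M, Q^T *m Q = 1%:M,
      A = P *m (\matrix_(i, j) if (i : nat) == j then s i.+1 else 0) *m Q^T &
      [/\ forall i, 0 <= s i,
          forall i j, (0 < i <= j)%N -> (j <= minn m p)%N -> s j <= s i &
          forall i, (i == 0)%N || (minn m p < i)%N -> s i = 0]].
Proof.
(* Indices start at 0, so along the diagonal the weights are positive, which will give the signs of
   the singular values, and strictly decreasing, which will give their order. *)
pose c (k : nat) : K := (minn m p - k)%:R.
pose C : 'M[K]_(m, p) := \matrix_(i, j) if (i : nat) == j then c i else 0.
have [P [Q [oP oQ maxPQ]]] := orthogonal_pair_max A C.
pose B := P^T *m A *m Q.
have maxB G H : G^T *m G = 1%:M -> H^T *m H = 1%:M ->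
    \tr (C^T *m (G^T *m B *m H)) <= \tr (C^T *m B).
  move=> oG oH; have := maxPQ _ _ (orthogonal_mul oP oG) (orthogonal_mul oQ oH).
  by rewrite trmx_mul !mulmxA.
have AE : A = P *m B *m Q^T.
  by rewrite /B !mulmxA (orthogonal_tr oP) mul1mx -mulmxA (orthogonal_tr oQ) mulmx1.
clearbody B.
have oT k (G : 'M[K]_k) : G^T *m G = 1%:M -> G^T^T *m G^T = 1%:M.
  by rewrite trmxK => /orthogonal_tr.
have o1 k : (1%:M : 'M[K]_k)^T *m 1%:M = 1%:M by rewrite trmx1 mulmx1.
(* Varying one factor at a time: the left one makes [B *m C^T] symmetric, the right one
   [C^T *m B]. *)
have symL : (B *m C^T)^T = B *m C^T.
  apply: trace_max_sym => G oG; have := maxB _ 1%:M (oT _ _ oG) (o1 _).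
  by rewrite trmxK mulmx1 mxtrace_mulC -mulmxA [\tr (C^T *m B)]mxtrace_mulC.
have symR : (C^T *m B)^T = C^T *m B.
  apply: trace_max_sym => G oG; have := maxB 1%:M _ (o1 _) oG.
  by rewrite trmx1 mul1mx mulmxA mxtrace_mulC.
have c_gt0 (i : 'I_m) (j : 'I_p) (k : nat) : (k <= i)%N -> (k <= j)%N -> 0 < c k.
  move=> ki kj; rewrite ltr0n subn_gt0 leq_min.
  by rewrite (leq_ltn_trans ki) // (leq_ltn_trans kj).
have BCE (a b : 'I_m) (k : 'I_p) : (k : nat) = b -> (B *m C^T) a b = B a k * c b.
  move=> kb; rewrite mxE (bigD1 k) //= big1 ?addr0; first by rewrite !mxE kb eqxx.
  move=> l lk; rewrite !mxE -kb eq_sym.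
  by rewrite (_ : (l : nat) == k = false) ?mulr0 //; exact: negPf.
have BC0 (a b : 'I_m) : (p <= b)%N -> (B *m C^T) a b = 0.
  move=> pb; rewrite mxE big1 // => l _; rewrite !mxE gtn_eqF ?mulr0 //.
  exact: leq_trans pb.
have CBE (a b : 'I_p) (k : 'I_m) : (k : nat) = a -> (C^T *m B) a b = c a * B k b.
  move=> kb; rewrite mxE (bigD1 k) //= big1 ?addr0; first by rewrite !mxE kb eqxx.
  move=> l lk; rewrite !mxE -kb.
  by rewrite (_ : (l : nat) == k = false) ?mul0r //; exact: negPf.
have CB0 (a b : 'I_p) : (m <= a)%N -> (C^T *m B) a b = 0.
  move=> pb; rewrite mxE big1 // => l _; rewrite !mxE ltn_eqF ?mul0r //.
  exact: leq_trans pb.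
have symLE a b : (B *m C^T) a b = (B *m C^T) b a by rewrite -{1}symL mxE.
have symRE a b : (C^T *m B) a b = (C^T *m B) b a by rewrite -{1}symR mxE.
(* The two symmetries read [B i j * c j = B j i * c i] and [c i * B i j = c j * B j i], whence
   [(c i ^ 2 - c j ^ 2) * B i j = 0]. Outside the square part one side is already 0 and the
   remaining weight is positive. *)
have offdiag (i : 'I_m) (j : 'I_p) : (i : nat) != j -> B i j = 0.
  move=> ij; have [jm|mj] := ltnP j m; last first.
    have ip : (i < p)%N by exact: ltn_trans (leq_trans (ltn_ord i) mj) (ltn_ord j).
    have := symRE (Ordinal ip) j; rewrite (CBE _ _ i) // (CB0 j) // => /eqP.
    rewrite mulf_eq0 gt_eqF /=; first by move/eqP.
    by apply: (c_gt0 i j) => //; exact: leq_trans (ltnW (ltn_ord i)) mj.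
  have [ip|pi] := ltnP i p; last first.
    have := symLE i (Ordinal jm); rewrite (BCE _ _ j) // (BC0 _ i) // => /eqP.
    rewrite mulf_eq0 orbC gt_eqF /=; first by move/eqP.
    by apply: (c_gt0 i j) => //; exact: leq_trans (ltnW (ltn_ord j)) pi.
  have e1 := symLE i (Ordinal jm); rewrite (BCE _ _ j) // (BCE _ _ (Ordinal ip)) //= in e1.
  have e2 := symRE (Ordinal ip) j; rewrite (CBE _ _ i) // (CBE _ _ (Ordinal jm)) //= in e2.
  have ci : 0 < c i by apply: (c_gt0 i (Ordinal ip)).
  have cj : 0 < c j by apply: (c_gt0 (Ordinal jm) j).
  have cij : c i - c j != 0.
    rewrite subr_eq0 eqr_nat; apply: contra ij => /eqP eij; apply/eqP.
    have im : (i <= minn m p)%N by rewrite leq_min (ltnW (ltn_ord i)) (ltnW ip).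
    have jm' : (j <= minn m p)%N by rewrite leq_min (ltnW jm) (ltnW (ltn_ord j)).
    by rewrite -(subKn im) eij subKn.
  have : (c i + c j) * (c i - c j) * B i j = 0.
    have -> : (c i + c j) * (c i - c j) * B i j = c i * (c i * B i j) - c j * (B i j * c j)
      by ring.
    by rewrite e1 e2; ring.
  by move/eqP; rewrite !mulf_eq0 (negPf cij) gt_eqF ?addr_gt0 //= => /eqP.
pose s k := if k is k'.+1 then
  if insub k' is Some i then if insub k' is Some j then B i j else 0 else 0 else 0.
have sE (i : 'I_m) (j : 'I_p) : (i : nat) = j -> s i.+1 = B i j.
  by move=> ij; rewrite /s valK ij valK.
have s0 i : (i == 0)%N || (minn m p < i)%N -> s i = 0.
  case: i => [//|k] /=; rewrite ltnS geq_min => /orP[mk|pk].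
    by rewrite insubN // -leqNgt.
  by case: insubP => // i _ _; rewrite insubN // -leqNgt.
clearbody s.
have BE : B = \matrix_(i, j) if (i : nat) == j then s i.+1 else 0.
  apply/matrixP => i j; rewrite mxE; have [/eqP/sE->//|ij] := boolP ((i : nat) == j).
  exact: offdiag.
exists P, Q, s; split => //.
  by rewrite -BE.
have s_in k : ~~ ((k == 0)%N || (minn m p < k)%N) ->
    exists (i : 'I_m) (j : 'I_p), (i : nat) = j /\ i.+1 = k.
  case: k => // k /=; rewrite -leqNgt leq_min => /andP[km kp].
  by exists (Ordinal km), (Ordinal kp).
split => //.
  move=> k; have [/s0->//|/s_in[i [j [ij <-]]]] := boolP ((k == 0)%N || (minn m p < k)%N).
  (* Reflecting coordinate [i] flips the sign of row [i]; a negative diagonal entry could thus be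
     improved. *)
  pose G : 'M[K]_m := 1%:M - 2 *: delta_mx i i.
  have Gt : G^T = G by rewrite /G linearB linearZ /= trmx1 trmx_delta.
  have oG : G^T *m G = 1%:M.
    rewrite Gt /G mulmxBl !mulmxBr !mulmx1 !mul1mx -!scalemxAl -!scalemxAr mul_delta_mx.
    by apply/matrixP => a b; rewrite !mxE; ring.
  have := maxB G 1%:M oG (o1 _); rewrite Gt mulmx1 /G mulmxBl mul1mx mulmxBr linearB /=.
  rewrite -scalemxAl -scalemxAr linearZ /= gerBl mxtrace_mulC -mulmxA trace_delta_mul.
  rewrite (BCE _ _ j) // (sE _ _ ij) pmulr_rge0 // pmulr_lge0 //.
  by apply: (c_gt0 i j); rewrite // ij.
move=> k l /andP[k0 kl] lm.
have [|i [j [ij ei]]] := s_in k.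
  by rewrite negb_or -lt0n k0 -leqNgt (leq_trans kl).
have [|i' [j' [ij' ei']]] := s_in l.
  by rewrite negb_or -lt0n (leq_trans k0) // -leqNgt.
rewrite -ei -ei'; rewrite -ei -ei' ltnS in kl.
have [->//|ii'] := eqVneq i i'.
have {}kl : (i < i')%N by rewrite ltn_neqAle kl andbT; exact: ii'.
have jj' : j != j' by rewrite -val_eqE /= -ij -ij'.
have oP' (n : nat) (t : 'S_n) : (perm_mx t : 'M[K]_n)^T *m perm_mx t = 1%:M.
  by rewrite tr_perm_mx -perm_mxM mulVg perm_mx1.
(* Swapping both index pairs exchanges two diagonal entries, changing the trace by
   [(s i'.+1 - s i.+1) * (c i - c i')]. *)
have := maxB _ _ (oP' _ (tperm i i')) (oP' _ (tperm j j')).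
have -> : (perm_mx (tperm i i'))^T *m B *m perm_mx (tperm j j') =
    B + (s i'.+1 - s i.+1) *: (delta_mx i j - delta_mx i' j').
  rewrite tr_perm_mx tpermV -row_permE -[tperm j j']tpermV -col_permE.
- apply/matrixP => a b; rewrite !mxE BE !mxE.
  have vE n (x y : 'I_n) : (x == y) = ((x : nat) == y) by [].
  have tE n (x y z : 'I_n) : (tperm x y z : nat) =
      if (z : nat) == x then nat_of_ord y else if (z : nat) == y then nat_of_ord x else z.
    by rewrite permE /= -!vE; do 2?[case: eqP => //].
  have ni : ((i : nat) == i') = false by exact: negPf.
  rewrite !tE !vE; move: ij ij' ni.
  move: (a : nat) (b : nat) (i : nat) (i' : nat) (j : nat) (j' : nat).
  move=> {}a {}b x y _ _ <- <- xy.
  have yx : (y == x) = false by rewrite eq_sym.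
  have [ax|ax] := eqVneq a x; have [ay|ay] := eqVneq a y;
  have [bx|bx] := eqVneq b x; have [b_y|b_y] := eqVneq b y; subst;
  rewrite ?eqxx ?xy ?yx /=; rewrite ?eqxx // in xy;
  repeat match goal with H : is_true (?u != ?v) |- _ =>
    pose proof (negbTE H); clear H end.
  all: repeat match goal with H : (?u == ?v) = false |- _ =>
    rewrite ?H ?(eq_sym v u) ?H; clear H end.
  all: rewrite /=; (try by ring).
rewrite mulmxDr linearD /= -scalemxAr linearZ /= gerDl mulmxBr linearB /=.
rewrite ![\tr (C^T *m _)]mxtrace_mulC !trace_delta_mul !mxE ij ij' !eqxx.
rewrite pmulr_lle0 ?subr_le0 // subr_gt0 ltr_nat ltn_sub2l //.
  by rewrite leq_min -{1}ij (ltn_ord i) ltn_ord.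
by rewrite -ij -ij'.
Qed.

End Svd.

(** * The Frobenius inner product *)

Lemma pow2_le_inv x y : 0 <= y -> x ^ 2 <= y ^ 2 -> x <= y.
Proof. by move=> y0 xy; case: (Rle_lt_dec x y) => // ?; nra. Qed.

Lemma mmulE m p q (A : 'M[R]_(m, p)) (B : 'M[R]_(p, q)) : mmul A B = A *m B.
Proof. by apply/matrixP => i j; rewrite !mxE. Qed.

Lemma maddE m p (A B : 'M[R]_(m, p)) : madd A B = (A + B)%R.
Proof. by apply/matrixP => i j; rewrite !mxE. Qed.

Lemma msubE m p (A B : 'M[R]_(m, p)) : msub A B = (A - B)%R.
Proof. by apply/matrixP => i j; rewrite !mxE. Qed.

Lemma mscaleE m p c (A : 'M[R]_(m, p)) : mscale c A = (c *: A)%R.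
Proof. by apply/matrixP => i j; rewrite !mxE. Qed.

Lemma orthogonalE k (Q : 'M[R]_k) : Defs.orthogonal Q <-> Q^T *m Q = (1%:M)%R.
Proof.
rewrite /Defs.orthogonal mmulE.
suff -> : mid k = (1%:M)%R by [].
by apply/matrixP => i j; rewrite !mxE; case: eqP.
Qed.

Lemma minnerE m p (A B : 'M[R]_(m, p)) : minner A B = \tr (A^T *m B).
Proof.
transitivity (\sum_i \sum_j A i j * B i j)%R; first by [].
rewrite exchange_big /mxtrace; apply: eq_bigr => j _.
by rewrite mxE; apply: eq_bigr => i _; rewrite mxE.
Qed.

Lemma sum_sqr_ge0 (I : finType) (F : I -> R) : 0 <= (\sum_i F i * F i)%R.
Proof. by apply/RleP/sumr_ge0 => i _; rewrite -expr2 sqr_ge0. Qed.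

Section Inner.
Variables m p : nat.
Implicit Types A B C : 'M[R]_(m, p).

Lemma minner_sym A B : minner A B = minner B A.
Proof. by rewrite !minnerE -[in RHS]mxtrace_tr trmx_mul trmxK. Qed.

Lemma minnerDr A B C : minner A (B + C)%R = minner A B + minner A C.
Proof. by rewrite !minnerE mulmxDr linearD. Qed.

Lemma minnerDl A B C : minner (A + B)%R C = minner A C + minner B C.
Proof. by rewrite minner_sym minnerDr !(minner_sym C). Qed.

Lemma minnerZr c A B : minner A (c *: B)%R = c * minner A B.
Proof. by rewrite !minnerE -scalemxAr linearZ. Qed.

Lemma minnerZl c A B : minner (c *: A)%R B = c * minner A B.
Proof. by rewrite minner_sym minnerZr minner_sym. Qed.

Lemma minnerNr A B : minner A (- B)%R = - minner A B.
Proof. by rewrite !minnerE mulmxN linearN. Qed.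

Lemma minnerNl A B : minner (- A)%R B = - minner A B.
Proof. by rewrite minner_sym minnerNr minner_sym. Qed.

Lemma minner_tr A B : minner A^T B^T = minner A B.
Proof. by rewrite !minnerE trmxK mxtrace_mulC -mxtrace_tr trmx_mul trmxK. Qed.

Lemma minner_ge0 A : 0 <= minner A A.
Proof.
by apply/RleP/sumr_ge0 => i _; apply/RleP; exact: sum_sqr_ge0.
Qed.

Lemma frob_ge0 A : 0 <= frob A.
Proof. exact: sqrt_pos. Qed.

Lemma frob_sqr A : frob A ^ 2 = minner A A.
Proof. by rewrite -[RHS](sqrt_def _ (minner_ge0 A)) /frob; ring. Qed.

Lemma frobN A : frob (- A)%R = frob A.
Proof. by rewrite /frob minnerNl minnerNr Ropp_involutive. Qed.

Lemma frob_tr A : frob A^T = frob A.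
Proof. by rewrite /frob minner_tr. Qed.

Lemma frobZ c A : 0 <= c -> frob (c *: A)%R = c * frob A.
Proof.
move=> c0; rewrite /frob minnerZl minnerZr -Rmult_assoc sqrt_mult.
- by rewrite sqrt_square.
- nra.
- exact: minner_ge0.
Qed.

(** Cauchy-Schwarz: [key] is [|A + t B|^2 >= 0], taken at its minimising [t]. If [|B| = 0] the
    expression is affine in [t], and a nonzero slope would let it reach -1. *)
Lemma minner_le A B : minner A B <= frob A * frob B.
Proof.
have a0 := frob_ge0 A; have b0 := frob_ge0 B.
have key t : 0 <= frob A ^ 2 + 2 * t * minner A B + t ^ 2 * frob B ^ 2.
  have := minner_ge0 (A + t *: B)%R.
  rewrite minnerDl !minnerDr !minnerZl !minnerZr (minner_sym B A) -!frob_sqr.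
  by move=> H; nra.
have [b1|b1] := Rle_lt_or_eq_dec _ _ b0.
  have := key (- (minner A B / frob B ^ 2)).
  have -> : frob A ^ 2 + 2 * - (minner A B / frob B ^ 2) * minner A B +
    (- (minner A B / frob B ^ 2)) ^ 2 * frob B ^ 2 =
    (frob A ^ 2 * frob B ^ 2 - minner A B ^ 2) / frob B ^ 2 by field; lra.
  move=> H; have {}H : 0 <= frob A ^ 2 * frob B ^ 2 - minner A B ^ 2.
    have b2 : 0 < frob B ^ 2 by nra.
    have := Rmult_le_pos _ _ H (Rlt_le _ _ b2).
    by rewrite /Rdiv Rmult_assoc Rinv_l ?Rmult_1_r //; lra.
  have ab : 0 <= frob A * frob B by nra.
  case: (Rle_lt_dec (minner A B) (frob A * frob B)) => // H1; nra.
rewrite -b1 in key *; rewrite Rmult_0_r.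
case: (Rle_lt_dec (minner A B) 0) => // H1.
have := key (- (frob A ^ 2 + 1) / (2 * minner A B)).
have -> : frob A ^ 2 + 2 * (- (frob A ^ 2 + 1) / (2 * minner A B)) * minner A B +
  (- (frob A ^ 2 + 1) / (2 * minner A B)) ^ 2 * 0 ^ 2 = - 1 by field; lra.
lra.
Qed.

Lemma minner_ge A B : - (frob A * frob B) <= minner A B.
Proof. by have := minner_le (- A)%R B; rewrite minnerNl frobN; lra. Qed.

Lemma frobD A B : frob (A + B)%R <= frob A + frob B.
Proof.
have a0 := frob_ge0 A; have b0 := frob_ge0 B.
apply: pow2_le_inv; first lra.
rewrite frob_sqr minnerDl !minnerDr (minner_sym B A) -!frob_sqr.
by have := minner_le A B; nra.
Qed.

Lemma frobB A B : frob (A - B)%R <= frob A + frob B.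
Proof. by have := frobD A (- B)%R; rewrite frobN. Qed.

End Inner.

Lemma minner_mull m p q (A : 'M[R]_(m, p)) (B : 'M[R]_(p, q)) C :
  minner (A *m B) C = minner B (A^T *m C).
Proof. by rewrite !minnerE trmx_mul mulmxA. Qed.

Lemma minner_mulr m p q (A : 'M[R]_(m, p)) (B : 'M[R]_(p, q)) C :
  minner (A *m B) C = minner A (C *m B^T).
Proof. by rewrite -minner_tr trmx_mul minner_mull -minner_tr !trmxK trmx_mul !trmxK. Qed.

Lemma frob_orthl m p (Q : 'M[R]_m) (A : 'M[R]_(m, p)) :
  Q^T *m Q = (1%:M)%R -> frob (Q *m A) = frob A.
Proof. by move=> oQ; rewrite /frob minner_mull mulmxA oQ mul1mx. Qed.

Lemma frob_orthr m p (Q : 'M[R]_p) (A : 'M[R]_(m, p)) :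
  Q^T *m Q = (1%:M)%R -> frob (A *m Q) = frob A.
Proof. by move=> /mulmx1C oQ; rewrite /frob minner_mulr -mulmxA oQ mulmx1. Qed.

(** * Singular values *)

(** Existence of a decomposition is exactly what makes the [epsilon] in [singval] meaningful. *)
Lemma singvalP m p (A : 'M[R]_(m, p)) : is_svals A (singval A).
Proof.
apply: (epsilon_spec (inhabits (fun _ : nat => 0)) (is_svals A)).
have [P [Q [s [oP oQ eA [s0 smono sz]]]]] := svd_exists A.
exists s; split; last split; last split.
- by move=> i _; apply/RleP.
- by move=> i j ij jm; apply/RleP; exact: smono.
- exact: sz.
by exists P, Q; rewrite !orthogonalE !mmulE.
Qed.

Lemma is_svals_ge0 m p (A : 'M[R]_(m, p)) s k : is_svals A s -> 0 <= s k.
Proof.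
move=> [s0 [_ [sz _]]].
have [/sz->|] := boolP ((k == 0)%N || (minn m p < k)%N); first exact: Rle_refl.
by rewrite negb_or -lt0n -leqNgt => /andP[k0 km]; apply: s0; rewrite k0 km.
Qed.

Lemma is_svals_le m p (A : 'M[R]_(m, p)) s i j : is_svals A s ->
  (0 < i <= j)%N -> s j <= s i.
Proof.
move=> sA ij; have si := is_svals_ge0 i sA; move: sA => [_ [sd [sz _]]].
by have [jm|mj] := leqP j (minn m p); [exact: sd|rewrite (sz j) // mj orbT].
Qed.

(** The middle dimension [p] cuts off all later diagonal entries, hence the vanishing condition on
    the products beyond it. *)
Lemma rdiagM m p q (s t : nat -> R) :
  (forall i, (p < i)%N -> s i * t i = 0) ->
  rdiag m p s *m rdiag p q t = rdiag m q (fun i => s i * t i).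
Proof.
move=> st; apply/matrixP => i j; rewrite !mxE.
have [ip|pi] := ltnP i p.
  rewrite (bigD1 (Ordinal ip)) //= big1 ?addr0 => [|k]; last first.
    by rewrite -val_eqE /= => ki; rewrite !mxE eq_sym (negPf ki) mul0r.
  rewrite !mxE /= eqxx; case: ifP => _ //; exact: mulr0.
rewrite big1 => [|k _]; first by case: ifP => // _; rewrite st // ltnS.
rewrite !mxE gtn_eqF ?mul0r //; exact: leq_trans (ltn_ord k) pi.
Qed.

Lemma tr_rdiag m p s : (rdiag m p s)^T = rdiag p m s.
Proof. by apply/matrixP => i j; rewrite !mxE eq_sym; case: eqP => // ->. Qed.

Definition row_sqr m p (Z : 'M[R]_(m, p)) (i : 'I_m) : R := (\sum_j Z i j * Z i j)%R.

Lemma Rmult_sumr (I : finType) (F : I -> R) c :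
  c * (\sum_i F i)%R = (\sum_i c * F i)%R.
Proof. exact: mulr_sumr. Qed.

Lemma row_sqr_ge0 m p (Z : 'M[R]_(m, p)) i : 0 <= row_sqr Z i.
Proof. exact: sum_sqr_ge0. Qed.

Lemma sum_row_sqr m p (Z : 'M[R]_(m, p)) : (\sum_i row_sqr Z i)%R = minner Z Z.
Proof. by []. Qed.

(** The row squares of [Q^T *m B] add up to [|B|^2], so each norm bound below reduces to comparing
    the weights [s_i^2] with one of them. *)
Lemma is_svals_quad m p (A : 'M[R]_(m, p)) s : is_svals A s ->
  exists Q : 'M[R]_p, Q^T *m Q = (1%:M)%R /\
  forall q (B : 'M[R]_(p, q)),
    minner (A *m B) (A *m B) = (\sum_(i < p) pow (s i.+1) 2 * row_sqr (Q^T *m B) i)%R.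
Proof.
move=> [s0 [sd [sz [P [Q]]]]]; rewrite !orthogonalE !mmulE => -[oP [oQ eA]].
exists Q; split=> // q B.
rewrite eA -!mulmxA -frob_sqr frob_orthl // frob_sqr minner_mull mulmxA tr_rdiag rdiagM.
  move: (Q^T *m B) => Z.
  apply: eq_bigr => i _; rewrite /row_sqr mulr_sumr; apply: eq_bigr => j _.
  rewrite [in LHS]mxE (bigD1 i) //= big1 ?addr0 => [|k ki]; last first.
    by rewrite mxE ifN ?mul0r // eq_sym; exact: ki.
  by rewrite mxE eqxx /= Rmult_1_r /GRing.mul /=; ring.
move=> i mi; rewrite sz ?Rmult_0_l //; apply/orP; right.
exact: leq_ltn_trans (geq_minl _ _) mi.
Qed.

Lemma frob_mul_snorm m p q (A : 'M[R]_(m, p)) (B : 'M[R]_(p, q)) :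
  frob (A *m B) <= snorm A * frob B.
Proof.
have sA := singvalP A; have [Q [oQ qA]] := is_svals_quad sA.
have s1 := is_svals_ge0 1 sA.
apply: pow2_le_inv; first by have := frob_ge0 B; rewrite /snorm; nra.
rewrite Rpow_mult_distr !frob_sqr qA.
rewrite -[minner B B]frob_sqr -(@frob_orthl _ _ Q^T) ?trmxK ?(mulmx1C oQ) //.
rewrite frob_sqr -sum_row_sqr [X in _ <= X]Rmult_sumr.
apply/RleP/ler_sum => i _; apply/RleP.
apply: Rmult_le_compat_r; first exact: row_sqr_ge0.
apply: pow_incr; split; first exact: is_svals_ge0 sA.
exact: is_svals_le sA _.
Qed.

(** The index is the number of columns: it gives the smallest weight, which is 0 by normalisation
    when [m < p] and a kernel exists. *)
Lemma singval_mul_frob m p q (A : 'M[R]_(m, p)) (B : 'M[R]_(p, q)) :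
  singval A p * frob B <= frob (A *m B).
Proof.
have sA := singvalP A; have [Q [oQ qA]] := is_svals_quad sA.
apply: pow2_le_inv; first exact: frob_ge0.
rewrite Rpow_mult_distr !frob_sqr qA.
rewrite -[minner B B]frob_sqr -(@frob_orthl _ _ Q^T) ?trmxK ?(mulmx1C oQ) //.
rewrite frob_sqr -sum_row_sqr [X in X <= _]Rmult_sumr.
apply/RleP/ler_sum => i _; apply/RleP.
apply: Rmult_le_compat_r; first exact: row_sqr_ge0.
apply: pow_incr; split; first exact: is_svals_ge0 sA.
apply: is_svals_le sA _; exact: ltn_ord.
Qed.

Lemma snorm_le_frob m p (A : 'M[R]_(m, p)) : snorm A <= frob A.
Proof.
have sA := singvalP A; have [Q [oQ qA]] := is_svals_quad sA.
apply: pow2_le_inv; first exact: frob_ge0.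
rewrite frob_sqr -[A in minner A _]mulmx1 -[A in minner _ A]mulmx1 qA mulmx1 /snorm.
case: p A sA Q oQ qA => [|p] A sA Q oQ qA.
  case: sA => _ [_ [sz _]]; rewrite sz ?ltnS ?geq_minr ?orbT //.
  by rewrite big_ord0 -R0E; lra.
have QQ (i : 'I_p.+1) : row_sqr Q^T i = 1.
  have /matrixP/(_ i i) := oQ; rewrite !mxE eqxx => e; rewrite R1E -[RHS]e.
  by apply: eq_bigr => j _; rewrite !mxE.
rewrite (bigD1 ord0) //= QQ; set u := (\sum_(_ | _) _)%R.
have : 0 <= u.
  apply/RleP/sumr_ge0 => i _; apply/RleP; rewrite QQ.
  by rewrite -RmultE Rmult_1_r; exact: pow2_ge_0.
by rewrite -RplusE -RmultE; lra.
Qed.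

(** The witness is the first right singular vector. Its norm is only bounded by 1 because for
    [p = 0] the sole vector is 0. *)
Lemma snorm_attained m p (A : 'M[R]_(m, p)) :
  exists v : 'cV[R]_p, frob v <= 1 /\ frob (A *m v) = snorm A.
Proof.
have sA := singvalP A; have [Q [oQ qA]] := is_svals_quad sA.
case: p A sA Q oQ qA => [|p] A sA Q oQ qA.
  exists 0%R; rewrite mulmx0 /snorm /frob.
  case: sA => _ [_ [sz _]]; rewrite sz ?ltnS ?geq_minr ?orbT //.
  have z k l : minner (0%R : 'M[R]_(k, l)) 0%R = 0.
    by apply: big1 => i _; apply: big1 => j _; rewrite !mxE; exact: mulr0.
  by rewrite !z sqrt_0; split; first lra.
pose e : 'cV[R]_p.+1 := delta_mx ord0 ord0.
have rs i : row_sqr e i = if i == ord0 then 1 else 0.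
  by rewrite /row_sqr big_ord1 mxE eqxx andbT; case: eqP => _; [exact: mulr1|exact: mulr0].
exists (Q *m e); split.
  rewrite frob_orthl // /frob -sum_row_sqr (bigD1 ord0) //= big1 ?addr0 ?rs.
    by rewrite sqrt_1; exact: Rle_refl.
  by move=> i i0; rewrite rs (negPf i0).
rewrite -[RHS](sqrt_pow2 (snorm A)); last exact: is_svals_ge0 sA.
rewrite /frob qA mulmxA oQ mul1mx; congr sqrt.
rewrite (bigD1 ord0) //= big1 ?addr0 ?rs.
  by rewrite /GRing.mul /= /snorm; ring.
by move=> i i0; rewrite rs (negPf i0) mulr0.
Qed.

Lemma snorm_lip m p (A B : 'M[R]_(m, p)) : snorm A <= snorm B + frob (A - B)%R.
Proof.
have [v [v1 <-]] := snorm_attained A.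
have -> : A *m v = (B *m v + (A - B) *m v)%R by rewrite -mulmxDl addrC subrK.
apply: Rle_trans (frobD _ _) _.
have h1 := frob_mul_snorm B v; have h2 := frob_mul_snorm (A - B)%R v.
have h3 := snorm_le_frob (A - B)%R.
have h4 : 0 <= snorm B by exact: is_svals_ge0 (singvalP B).
have h5 : 0 <= snorm (A - B)%R by exact: is_svals_ge0 (singvalP _).
have := frob_ge0 v; nra.
Qed.

(* Courant-Fischer: some nonzero [v] is supported on the first [k] right
   singular vectors of one decomposition and orthogonal to the first [k - 1]
   of the other. *)
Lemma is_svals_le_uniq m p (A : 'M[R]_(m, p)) s t :
  is_svals A s -> is_svals A t -> forall k, s k <= t k.
Proof.
move=> sA tA k.
have [/(proj1 (proj2 (proj2 sA)))->|] := boolP ((k == 0)%N || (minn m p < k)%N).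
  exact: is_svals_ge0 tA.
rewrite negb_or -lt0n -leqNgt leq_min => /and3P[k0 km kp].
have [Q [oQ qA]] := is_svals_quad sA; have [Q' [oQ' qA']] := is_svals_quad tA.
(* Row [k - 1], counted from 0, stays zero: this makes [T] singular, and a kernel vector satisfies
   both families of orthogonality conditions. *)
pose T : 'M[R]_p := \matrix_(i, j)
  (if (i.+1 < k)%N then Q'^T i j else if (k <= i)%N then Q^T i j else 0)%R.
have k1p : (k.-1 < p)%N by case: k k0 kp {km T}.
have T0 : \det T^T = 0%R.
  rewrite det_tr (expand_det_row _ (Ordinal k1p)) big1 // => j _.
  by rewrite mxE /= prednK // ltnn leqNgt prednK // leqnn mul0r.
have /det0P[v v0 vT] := introT eqP T0.
have Tv : T *m v^T = 0%R by rewrite -[T]trmxK -trmx_mul vT trmx0.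
have zQ (i : 'I_p) : (k <= i)%N -> row_sqr (Q^T *m v^T) i = 0.
  move=> ki; rewrite /row_sqr big1 // => j _.
  have /matrixP/(_ i j) := Tv; rewrite !mxE => e.
  rewrite (_ : (\sum_k0 _)%R = 0%R) ?mul0r // -[RHS]e; apply: eq_bigr => l _.
  by rewrite !mxE ltnNge (leq_trans ki) // ki.
have zQ' (i : 'I_p) : (i.+1 < k)%N -> row_sqr (Q'^T *m v^T) i = 0.
  move=> ki; rewrite /row_sqr big1 // => j _.
  have /matrixP/(_ i j) := Tv; rewrite !mxE => e.
  rewrite (_ : (\sum_k0 _)%R = 0%R) ?mul0r // -[RHS]e; apply: eq_bigr => l _.
  by rewrite !mxE ki.
have nQ (P : 'M[R]_p) : P^T *m P = (1%:M)%R ->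
    (\sum_i row_sqr (P^T *m v^T) i)%R = minner v^T v^T.
  move=> oP; rewrite sum_row_sqr -!frob_sqr frob_orthl //.
  by rewrite trmxK (mulmx1C oP).
have vpos : 0 < minner v^T v^T.
  have [//|e] := Rle_lt_or_eq_dec _ _ (minner_ge0 v^T).
  case/negP: v0; apply/eqP/matrixP => i j; rewrite mxE ord1.
  have /eqP := esym e; rewrite psumr_eq0 => [|l _]; last first.
    by apply/RleP/sum_sqr_ge0.
  move/allP/(_ j (mem_index_enum _)) => /=.
  rewrite /rsum big_ord1 !mxE => /eqP/Rmult_integral [] //.
have h1 : s k ^ 2 * minner v^T v^T <= minner (A *m v^T) (A *m v^T).
  rewrite qA -(nQ _ oQ) [X in X <= _]Rmult_sumr; apply/RleP/ler_sum => i _; apply/RleP.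
  have [ki|ik] := leqP k i; first by rewrite zQ // ![GRing.mul _ _]mulr0; exact: Rle_refl.
  apply: Rmult_le_compat_r; first exact: row_sqr_ge0.
  apply: pow_incr; split; first exact: is_svals_ge0 sA.
  exact: is_svals_le sA _.
have h2 : minner (A *m v^T) (A *m v^T) <= t k ^ 2 * minner v^T v^T.
  rewrite qA' -(nQ _ oQ') [X in _ <= X]Rmult_sumr; apply/RleP/ler_sum => i _; apply/RleP.
  have [ki|ik] := ltnP i.+1 k; first by rewrite zQ' // ![GRing.mul _ _]mulr0; exact: Rle_refl.
  apply: Rmult_le_compat_r; first exact: row_sqr_ge0.
  apply: pow_incr; split; first exact: is_svals_ge0 tA.
  by apply: is_svals_le tA _; rewrite k0.
apply: pow2_le_inv; first exact: is_svals_ge0 tA.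
exact: Rmult_le_reg_r vpos (Rle_trans _ _ _ h1 h2).
Qed.

Lemma singval_uniq m p (A : 'M[R]_(m, p)) s k : is_svals A s -> singval A k = s k.
Proof.
by move=> sA; apply: Rle_antisym; [exact: (is_svals_le_uniq (singvalP A) sA)|
  exact: (is_svals_le_uniq sA (singvalP A))].
Qed.

Lemma singval_gram m p (A : 'M[R]_(m, p)) k :
  singval (A *m A^T) k = singval A k ^ 2.
Proof.
have sA := singvalP A; apply: (singval_uniq (s := fun k => singval A k ^ 2)).
rewrite /is_svals minnn.
split=> [i _|]; first exact: pow2_ge_0.
split=> [i j ij _|].
  by apply: pow_incr; split; [exact: is_svals_ge0 sA|exact: is_svals_le sA ij].
case: sA => _ [_ [sz [P [Q]]]]; rewrite !orthogonalE !mmulE => -[oP [oQ eA]].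
split=> [i i0|].
  rewrite sz /=; first ring.
  by case/orP: i0 => [->//|mi]; rewrite (leq_ltn_trans (geq_minl _ _) mi) orbT.
exists P, P; rewrite !orthogonalE !mmulE; split=> //; split=> //.
rewrite {1 2}eA !trmx_mul trmxK tr_rdiag !mulmxA.
rewrite -(mulmxA _ Q^T) oQ mulmx1 -(mulmxA P) rdiagM.
  by congr (_ *m _ *m _); apply/matrixP => i j; rewrite !mxE /= Rmult_1_r.
move=> i pi; rewrite sz ?Rmult_0_l //; apply/orP; right.
exact: leq_ltn_trans (geq_minr _ _) pi.
Qed.

(** * Procrustes distance, positive semidefinite matrices and rank *)

Lemma frobB_sqr m p (A B : 'M[R]_(m, p)) :
  frob (A - B)%R ^ 2 = frob A ^ 2 - 2 * minner A B + frob B ^ 2.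
Proof.
rewrite !frob_sqr minnerDl !minnerDr !minnerNl !minnerNr (minner_sym B A); ring.
Qed.

(** Expanding the square, [|U - V Q|^2] depends on the rotation only through the trace of [U^T V Q],
    so minimising the distance is maximising a trace. The maximising pair merges into the single
    rotation [Q *m P^T]. *)
Lemma Dist_spec n r (U V : 'M[R]_(n, r)) :
  (exists Q : 'M[R]_r, Defs.orthogonal Q /\ Dist U V = frob (msub U (mmul V Q))) /\
  (forall Q : 'M[R]_r, Defs.orthogonal Q -> Dist U V <= frob (msub U (mmul V Q))).
Proof.
apply: (epsilon_spec (inhabits 0) (fun d =>
    (exists Q : 'M[R]_r, Defs.orthogonal Q /\ d = frob (msub U (mmul V Q))) /\
    (forall Q : 'M[R]_r, Defs.orthogonal Q -> d <= frob (msub U (mmul V Q))))).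
have [P [Q [oP oQ maxPQ]]] := orthogonal_pair_max (U^T *m V) (1%:M)%R.
exists (frob (msub U (mmul V (Q *m P^T)))); split.
  exists (Q *m P^T); split=> //; apply/orthogonalE.
  by apply: orthogonal_mul => //; rewrite trmxK; exact: orthogonal_tr.
move=> S /orthogonalE oS; rewrite !msubE !mmulE.
apply: pow2_le_inv; first exact: frob_ge0.
rewrite !frobB_sqr mulmxA (@frob_orthr _ _ P^T) ?trmxK ?(mulmx1C oP) //.
rewrite !frob_orthr // !minnerE.
suff : \tr (U^T *m (V *m S)) <= \tr (U^T *m (V *m Q *m P^T)) by lra.
have := maxPQ (1%:M)%R S _ oS; rewrite !trmx1 !mul1mx => /(_ erefl) /RleP.
by rewrite -[X in _ <= \tr X]mulmxA [X in _ <= X]mxtrace_mulC !mulmxA.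
Qed.

Lemma Dist_le n r (U V : 'M[R]_(n, r)) (Q : 'M[R]_r) :
  Q^T *m Q = (1%:M)%R -> Dist U V <= frob (U - V *m Q)%R.
Proof.
by move=> /orthogonalE oQ; have := proj2 (Dist_spec U V) Q oQ; rewrite msubE mmulE.
Qed.

Lemma Dist_attained n r (U V : 'M[R]_(n, r)) : exists Q : 'M[R]_r,
  [/\ Q^T *m Q = (1%:M)%R, Dist U V = frob (U - V *m Q)%R &
      (U^T *m (V *m Q))^T = U^T *m (V *m Q)].
Proof.
have [[Q [/orthogonalE oQ eQ]] _] := Dist_spec U V.
rewrite msubE mmulE in eQ; exists Q; split=> //.
apply: trace_max_sym => G oG; apply/RleP.
(* Compared with the rotation [Q *m G], only the trace term of the expanded square differs. *)
have := Dist_le U V (orthogonal_mul oQ oG).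
rewrite eQ => le; have := pow_incr _ _ 2 (conj (frob_ge0 _) le).
rewrite !frobB_sqr (mulmxA V) (@frob_orthr _ _ G) // !minnerE.
rewrite (mxtrace_mulC G) -!mulmxA => H.
suff : \tr (U^T *m (V *m (Q *m G))) <= \tr (U^T *m (V *m Q)) by [].
by lra.
Qed.

Lemma psdP n (X : 'M[R]_n) :
  is_psd X <-> X^T = X /\ forall v : 'cV[R]_n, 0 <= minner v (X *m v).
Proof.
have E (v : 'I_n -> R) (w : 'cV[R]_n) : (forall i, v i = w i ord0) ->
    rsum (fun i => rsum (fun j => v i * X i j * v j)) = minner w (X *m w).
  move=> vw; apply: eq_bigr => i _; rewrite /rsum big_ord1 mxE vw.
  rewrite [RHS]Rmult_sumr; apply: eq_bigr => j _.
  by rewrite !vw; exact: Rmult_assoc.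
split=> -[sX pX]; split=> // v.
  by rewrite -(E (fun i => v i ord0)).
by rewrite (E _ (\col_i v i)%R) => [//|i]; rewrite mxE.
Qed.

Lemma psd_gram n r (A : 'M[R]_(n, r)) : is_psd (A *m A^T).
Proof.
apply/psdP; rewrite trmx_mul trmxK; split=> // v.
by rewrite -mulmxA minner_sym minner_mull; exact: minner_ge0.
Qed.

Lemma psdD n (X Y : 'M[R]_n) : is_psd X -> is_psd Y -> is_psd (X + Y)%R.
Proof.
move=> /psdP[sX pX] /psdP[sY pY]; apply/psdP; rewrite linearD /= sX sY.
by split=> // v; rewrite mulmxDl minnerDr; have := pX v; have := pY v; lra.
Qed.

Lemma psdZ n c (X : 'M[R]_n) : 0 <= c -> is_psd X -> is_psd (c *: X)%R.
Proof.
move=> c0 /psdP[sX pX]; apply/psdP; rewrite linearZ /= sX.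
by split=> // v; rewrite -scalemxAl minnerZr; have := pX v; nra.
Qed.

Lemma psd_tr n (X : 'M[R]_n) : is_psd X -> X^T = X.
Proof. by case. Qed.

Lemma psd_rdiag n (V : 'M[R]_n) (d : nat -> R) : (forall i, (0 < i <= n)%N -> 0 <= d i) ->
  is_psd (V *m rdiag n n d *m V^T).
Proof.
(* The square root is cut to 0 beyond [n] to meet the condition of [rdiagM]. *)
move=> d0; pose s i := if (i <= n)%N then sqrt (d i) else 0.
have -> : V *m rdiag n n d *m V^T = (V *m rdiag n n s) *m (V *m rdiag n n s)^T.
  rewrite trmx_mul tr_rdiag !mulmxA -(mulmxA V (rdiag _ _ s)) rdiagM.
    congr (_ *m _ *m _); apply/matrixP => i j; rewrite !mxE; case: eqP => // _.
    by rewrite /s ltn_ord sqrt_sqrt //; apply: d0; rewrite ltn_ord.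
  by move=> i ni; rewrite /s leqNgt ni Rmult_0_l.
exact: psd_gram.
Qed.

(** Nonnegative sorted eigenvalues with [V] on both sides form a singular value decomposition, so
    uniqueness identifies [lam] with [singval X] whichever decomposition was given. *)
Lemma best_rank_approx_singval n r (X Xr : 'M[R]_n) i : best_rank_approx X r Xr ->
  singval Xr i = if (i <= r)%N then singval X i else 0.
Proof.
move=> [V [lam [oV [l0 [ld [eX eXr]]]]]].
have sv (d : nat -> R) : (forall i, (0 < i <= n)%N -> 0 <= d i) ->
    (forall i j, (0 < i <= j)%N -> (j <= n)%N -> d j <= d i) ->
    is_svals (mmul (mmul V (rdiag n n d)) V^T)
      (fun i => if (0 < i <= n)%N then d i else 0).
  move=> d0 dd; split; last split; last split; rewrite ?minnn.
  - by move=> k kn; rewrite kn; exact: d0.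
  - move=> k l /andP[k0 kl] ln; rewrite k0 ln (leq_trans kl ln) (leq_trans k0 kl) /=.
    by apply: dd; rewrite ?k0.
  - by move=> k /orP[/eqP->//|nk]; rewrite andbC leqNgt nk.
  exists V, V; split=> //; split=> //; rewrite !mmulE; congr (_ *m _ *m _).
  by apply/matrixP => k l; rewrite !mxE ltn_ord.
rewrite eXr (singval_uniq i (sv _ _ _)); last 2 first.
- by move=> k kn; case: ifP => _; [exact: l0|exact: Rle_refl].
- move=> k l /andP[k0 kl] ln; case: ifP => lr; last first.
    by case: ifP => _; [apply: l0; rewrite k0 (leq_trans kl ln)|exact: Rle_refl].
  by rewrite (leq_trans kl lr); apply: ld; rewrite ?k0.
by rewrite eX (singval_uniq i (sv _ l0 ld)); case: ifP; case: ifP.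
Qed.

(** The residual keeps the tail of the spectrum. The gradient at [Xs] therefore pairs nonnegatively
    with it, which removes the first-order term when [f Xsr] is compared with [f Xs]. *)
Lemma best_rank_approx_residual_psd n r (X Xr : 'M[R]_n) : best_rank_approx X r Xr ->
  is_psd (X - Xr)%R.
Proof.
move=> [V [lam [oV [l0 [ld [eX eXr]]]]]].
have -> : (X - Xr)%R =
    V *m rdiag n n (fun i => if (i <= r)%N then 0 else lam i) *m V^T.
  rewrite eX eXr !mmulE -mulmxBl -mulmxBr; congr (_ *m _ *m _).
  apply/matrixP => i j; rewrite !mxE; case: eqP => _; last exact: subrr.
  by case: ifP => _; [exact: subrr|exact: subr0].
by apply: psd_rdiag => i ni; case: ifP => _; [exact: Rle_refl|exact: l0].
Qed.

Lemma rank_ge_mxrank m p (A : 'M[R]_(m, p)) k : rank_ge A k -> (k <= \rank A)%N.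
Proof.
move=> [c indep].
have free : row_free (rowsub c A^T).
  apply: inj_row_free => v vA; apply/matrixP => i j; rewrite mxE ord1.
  apply: (indep (fun j => v ord0 j)) => k'.
  have /matrixP/(_ ord0 k') := vA; rewrite !mxE => e; rewrite -[RHS]e.
  by apply: eq_bigr => l _; rewrite !mxE.
by rewrite -[X in (X <= _)%N](eqP free) -[X in (_ <= X)%N]mxrank_tr rowsubE mxrankM_maxr.
Qed.

Lemma rank_le_gram n r (A : 'M[R]_(n, r)) : rank_le (A *m A^T) r.
Proof.
move=> k /rank_ge_mxrank kA; apply: leq_trans kA _.
exact: leq_trans (mxrankM_maxl _ _) (rank_leq_col _).
Qed.

(** If the [k]-th value vanished, so would all later ones, and the diagonal factor would pass
    through dimension [k - 1]. *)
Lemma rank_ge_singval_gt0 m p (A : 'M[R]_(m, p)) k :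
  (0 < k)%N -> rank_ge A k -> 0 < singval A k.
Proof.
case: k => // k _ /rank_ge_mxrank kA; have sA := singvalP A.
have [//|s0] := Rle_lt_or_eq_dec _ _ (is_svals_ge0 k.+1 sA).
have sk i : (k < i)%N -> singval A i = 0.
  move=> ki; apply: Rle_antisym; last exact: is_svals_ge0 sA.
  by rewrite s0; apply: is_svals_le sA _.
case: (sA) => _ [_ [_ [P [Q [_ [_ eA]]]]]].
suff : (\rank A <= k)%N by rewrite leqNgt kA.
rewrite eA !mmulE -(_ : rdiag m k (singval A) *m rdiag k p (fun=> 1) = rdiag m p (singval A)).
  rewrite -!mulmxA mulmxA; apply: leq_trans (mxrankM_maxl _ _) (rank_leq_col _).
rewrite rdiagM => [|i ki]; last by rewrite sk // Rmult_0_l.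
by congr (rdiag _ _ _); apply: functional_extensionality => i; ring.
Qed.

(** * Gradients *)

Lemma frobZ_abs m p c (A : 'M[R]_(m, p)) : frob (c *: A)%R = Rabs c * frob A.
Proof.
have [c0|c0] := Rle_lt_dec 0 c; first by rewrite frobZ // Rabs_pos_eq.
rewrite Rabs_left // -frobZ; last lra.
by rewrite RoppE scaleNr frobN.
Qed.

Lemma frob_mul m p q (A : 'M[R]_(m, p)) (B : 'M[R]_(p, q)) :
  frob (A *m B) <= frob A * frob B.
Proof.
apply: Rle_trans (frob_mul_snorm A B) _.
by apply: Rmult_le_compat_r (snorm_le_frob A); exact: frob_ge0.
Qed.

Lemma has_gradient_derivable n (f : 'M[R]_n -> R) gradf (X H : 'M[R]_n) t :
  has_gradient f gradf ->
  derivable_pt_lim (fun s => f (X + s *: H)%R) t (minner (gradf (X + t *: H)%R) H).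
Proof.
move=> fg eps eps0; have w0 := frob_ge0 H; set w := frob H in w0.
have w1 : 0 < / (w + 1) by apply: Rinv_0_lt_compat; lra.
(* Dividing by [w + 1] instead of [w] covers [H = 0] and leaves the slack for the strict
   inequality. *)
have [|delta [d0 fd]] := fg (X + t *: H)%R (eps / (w + 1)); first by rewrite /Rdiv; nra.
have d1 : 0 < delta / (w + 1) by rewrite /Rdiv; nra.
exists (mkposreal _ d1) => h h0 /= hd.
have ew1 : / (w + 1) * (w + 1) = 1 by field; lra.
have ah : 0 < Rabs h by exact: Rabs_pos_lt.
have := fd (h *: H)%R; rewrite maddE frobZ_abs -/w minnerZr -addrA -scalerDl -RplusE.
have hw : Rabs h * w < delta.
  have : Rabs h * (w + 1) < delta.
    have := Rmult_lt_compat_r (w + 1) _ _ ltac:(lra) hd.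
    by rewrite /Rdiv Rmult_assoc ew1 Rmult_1_r.
  nra.
move=> /(_ hw) le.
rewrite (_ : _ - _ = (f (X + Rplus t h *: H)%R - f (X + t *: H)%R -
  h * minner (gradf (X + t *: H)%R) H) / h); last by field.
rewrite /Rdiv Rabs_mult Rabs_inv.
apply: (Rmult_lt_reg_r (Rabs h)) => //.
rewrite Rmult_assoc Rinv_l ?Rmult_1_r; last lra.
apply: Rle_lt_trans le _.
have -> : eps / (w + 1) * (Rabs h * w) = eps * Rabs h * (w / (w + 1)) by field; lra.
have -> : w / (w + 1) = 1 - / (w + 1) by field; lra.
by have : 0 < eps * Rabs h * / (w + 1) by [apply: Rmult_lt_0_compat => //; nra]; lra.
Qed.

(** [X + h W] stays in the cone for [h > 0], so a negative slope would contradict minimality. *)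
Lemma gradient_psd_ge0 n (f : 'M[R]_n -> R) gradf (X W : 'M[R]_n) :
  has_gradient f gradf -> is_psd X -> (forall Y, is_psd Y -> f X <= f Y) ->
  is_psd W -> 0 <= minner (gradf X) W.
Proof.
move=> fg pX minX pW; have D := has_gradient_derivable X W 0 fg.
rewrite R0E scale0r addr0 -R0E in D.
have [//|g0] := Rle_lt_dec 0 (minner (gradf X) W).
have [delta fd] := D _ (Ropp_0_gt_lt_contravar _ g0).
have d0 := cond_pos delta; pose h : R := delta / 2.
have h0 : 0 < h < delta by rewrite /h; lra.
have := fd h; rewrite Rabs_pos_eq; last lra.
move=> /(_ ltac:(lra) ltac:(lra)) /Rabs_def2 [lt _].
have le : f X <= f (X + h *: W)%R.
  by apply: minX; apply: psdD => //; apply: psdZ => //; lra.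
move: lt; rewrite Rplus_0_l R0E scale0r addr0.
have : 0 <= (f (X + h *: W)%R - f X) / h.
  by apply: Rmult_le_pos; [lra|apply/Rlt_le/Rinv_0_lt_compat; lra].
lra.
Qed.

Lemma minner_eq0 m p (A : 'M[R]_(m, p)) : minner A A = 0 -> A = 0%R.
Proof.
move=> /eqP; rewrite psumr_eq0 => [/allP A0|i _]; last by apply/RleP/sum_sqr_ge0.
apply/matrixP => i j; rewrite mxE.
have := A0 i (mem_index_enum _); rewrite /= psumr_eq0 => [/allP Ai|k _]; last first.
  by have := sqr_ge0 (A i k); rewrite expr2.
by have /eqP/Rmult_integral [] := Ai j (mem_index_enum _).
Qed.

(** With [K = G - G^T] antisymmetric, [f (X + s K) = f (X - s K)]; hence [<G, K> = 0], and
    [<K, K> = 2 <G, K>]. *)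
Lemma gradient_tr n (f : 'M[R]_n -> R) gradf (X : 'M[R]_n) :
  has_gradient f gradf -> symmetric_fun f -> X^T = X -> (gradf X)^T = gradf X.
Proof.
move=> fg fs sX; set G := gradf X; pose K := (G - G^T)%R.
have D H : derivable_pt_lim (fun s => f (X + s *: H)%R) 0 (minner G H).
  by have := has_gradient_derivable X H 0 fg; rewrite R0E scale0r addr0.
have e : minner G K = minner G K^T.
  apply: (uniqueness_limite (fun s => f (X + s *: K)%R) 0); first exact: D.
  rewrite (_ : (fun s => _) = (fun s => f (X + s *: K^T)%R)); first exact: D.
  apply: functional_extensionality => s.
  by rewrite fs linearD linearZ /= sX.
have Kt : K^T = (- K)%R by rewrite /K linearB /= trmxK opprB.
have /minner_eq0/eqP : minner K K = 0.
  rewrite Kt minnerNr in e.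
  have e' : minner G^T K = - minner G K by rewrite -minner_tr trmxK Kt minnerNr.
  rewrite {1}/K minnerDl minnerNl e'; lra.
by rewrite subr_eq0 => /eqP.
Qed.

(** The mean value theorem replaces integration: [phi] subtracts the claimed bound, and its
    derivative at the intermediate point is nonpositive. Smoothness holds on the cone only, which
    contains the segment by convexity. *)
Lemma smooth_upper n (f : 'M[R]_n -> R) gradf M (X Y : 'M[R]_n) :
  has_gradient f gradf -> smooth gradf M -> is_psd X -> is_psd Y ->
  f Y <= f X + minner (gradf X) (Y - X)%R + M / 2 * frob (Y - X)%R ^ 2.
Proof.
move=> fg sm pX pY; set H := (Y - X)%R.
pose phi t := f (X + t *: H)%R - t * minner (gradf X) H - M / 2 * frob H ^ 2 * t ^ 2.
have [c [phi01 [c0 c1]]] : exists c, phi 1 - phi 0 =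
    (minner (gradf (X + c *: H)%R) H - minner (gradf X) H - M * frob H ^ 2 * c) * (1 - 0) /\
    0 < c < 1.
  apply: (MVT_cor2 phi) => [|c _]; first lra.
  apply: derivable_pt_lim_minus.
    apply: derivable_pt_lim_minus; first exact: has_gradient_derivable.
    have := derivable_pt_lim_mult id (fct_cte (minner (gradf X) H)) c _ _
      (derivable_pt_lim_id c) (derivable_pt_lim_const _ c).
    by rewrite /mult_fct /fct_cte /id Rmult_0_r Rplus_0_r Rmult_1_l.
  have := derivable_pt_lim_scal (fun x => x ^ 2) (M / 2 * frob H ^ 2) c _
    (derivable_pt_lim_pow c 2).
  rewrite /mult_real_fct /= Rmult_1_r.
  by congr derivable_pt_lim; field.
have pc : is_psd (X + c *: H)%R.
  rewrite (_ : (X + c *: H)%R = (Rminus 1 c *: X + c *: Y)%R).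
    by apply: psdD; apply: psdZ => //; lra.
  by rewrite /H scalerBr RminusE scalerBl R1E scale1r addrA addrAC.
have := sm _ _ pc pX; rewrite !msubE (_ : (X + c *: H - X)%R = (c *: H)%R); last first.
  by rewrite addrAC subrr add0r.
rewrite frobZ; last lra.
move=> gl; have := minner_le (gradf (X + c *: H)%R - gradf X)%R H.
rewrite minnerDl minnerNl => gi; have h0 := frob_ge0 H.
have := Rmult_le_compat_r _ _ _ h0 gl; move: phi01.
rewrite /phi R1E R0E scale1r scale0r addr0 -R1E -R0E.
have -> : (X + H)%R = Y by rewrite /H addrC subrK.
by nra.
Qed.

(** The first-order gain is [2 eta |H|^2] with [H = G U]. Rewriting [H H^T] as [G (U H^T)] bounds
    the remaining terms by [1/10 + (1/20) (2 + 1/10)^2 < 1] times [eta |H|^2], so half of the gain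
    survives. *)
Lemma gradient_step_decrease n r (f : 'M[R]_n -> R) gradf M eta (U : 'M[R]_(n, r)) :
  let X := U *m U^T in let G := gradf X in
  has_gradient f gradf -> symmetric_fun f -> smooth gradf M ->
  0 <= M -> 0 <= eta -> eta * snorm G <= / 10 -> eta * (M * snorm X) <= / 10 ->
  exists Y, is_psd Y /\ f Y <= f X - eta * frob (G *m U) ^ 2.
Proof.
move=> X G fg fs sm M0 e0 eG eX; have pX : is_psd X by exact: psd_gram.
have sG : G^T = G by apply: gradient_tr fg fs (psd_tr pX).
pose H := G *m U; pose Y := (U - eta *: H)%R *m ((U - eta *: H)%R)^T.
have pY : is_psd Y by exact: psd_gram.
exists Y; split=> //; apply: Rle_trans (smooth_upper fg sm pX pY) _.
set W := (Y - X)%R.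
have g0 : 0 <= snorm G by exact: is_svals_ge0 (singvalP G).
have u0 : 0 <= snorm U by exact: is_svals_ge0 (singvalP U).
have h0 := frob_ge0 H; rewrite -/G -/H.
have eYX : W = (- (eta *: (H *m U^T + U *m H^T)) + (Rmult eta eta) *: (H *m H^T))%R.
  rewrite /W; have -> : Y = (U - eta *: H)%R *m (U^T - eta *: H^T)%R.
    by congr (_ *m _); rewrite linearB linearZ.
  rewrite mulmxBl !mulmxBr -!scalemxAl -!scalemxAr scalerA -/X.
  move: (U *m H^T) (H *m U^T) (H *m H^T) (X) => A B C D'.
  by rewrite opprB addrC !addrA addNr add0r [LHS]addrC addrA scalerDr opprD.
have nHU : frob (U *m H^T) <= snorm U * frob H.
  by rewrite -(frob_tr H); exact: frob_mul_snorm.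
have nUH : frob (H *m U^T) <= snorm U * frob H.
  by rewrite -frob_tr trmx_mul trmxK.
have nHH : frob (H *m H^T) <= snorm G * (snorm U * frob H).
  rewrite {1}/H -mulmxA; apply: Rle_trans (frob_mul_snorm _ _) _.
  exact: Rmult_le_compat_l.
have eX2 : snorm X = snorm U ^ 2 by exact: singval_gram.
have nW : frob W <= eta * (snorm U * frob H) * (2 + eta * snorm G).
  rewrite eYX; apply: Rle_trans (frobD _ _) _; rewrite frobN !frobZ //; last nra.
  have sum : frob (H *m U^T + U *m H^T)%R <= 2 * (snorm U * frob H).
    by apply: Rle_trans (frobD _ _) _; lra.
  have := Rmult_le_compat_l eta _ _ e0 sum.
  have := Rmult_le_compat_l (eta * eta) _ _ (Rmult_le_pos _ _ e0 e0) nHH.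
  lra.
have iW : minner G W <= - 2 * eta * frob H ^ 2 + eta * eta * (snorm G * frob H ^ 2).
  rewrite eYX minnerDr minnerNr !minnerZr minnerDr.
  have -> : minner G (H *m U^T) = frob H ^ 2.
    by rewrite minner_sym minner_mulr trmxK -/H frob_sqr.
  have -> : minner G (U *m H^T) = frob H ^ 2.
    by rewrite minner_sym minner_mull minner_sym -minner_tr trmxK trmx_mul trmxK sG -/H frob_sqr.
  have -> : minner G (H *m H^T) = minner (G *m H) H.
    by rewrite minner_sym minner_mulr trmxK minner_sym.
  have gh : minner (G *m H) H <= snorm G * frob H ^ 2.
    apply: Rle_trans (minner_le _ _) _.
    have -> : snorm G * frob H ^ 2 = snorm G * frob H * frob H by ring.
    by apply: Rmult_le_compat_r => //; exact: frob_mul_snorm.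
  have := Rmult_le_compat_l (eta * eta) _ _ (Rmult_le_pos _ _ e0 e0) gh.
  lra.
have W0 := frob_ge0 (Y - X)%R.
have a0 : 0 <= eta * snorm G by exact: Rmult_le_pos.
have sW : frob W ^ 2 <= (eta * (snorm U * frob H) * (2 + eta * snorm G)) ^ 2.
  by apply: pow_incr; split.
have : M / 2 * frob W ^ 2 <= eta * frob H ^ 2 * (/ 2 * / 10 * (2 + / 10) ^ 2).
  have : M / 2 * frob W ^ 2 <=
      M / 2 * (eta * (snorm U * frob H) * (2 + eta * snorm G)) ^ 2.
    by apply: Rmult_le_compat_l => //; lra.
  have -> : M / 2 * (eta * (snorm U * frob H) * (2 + eta * snorm G)) ^ 2 =
      eta * frob H ^ 2 * (/ 2 * (eta * (M * snorm X)) * (2 + eta * snorm G) ^ 2).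
    by rewrite eX2; field.
  move=> h; apply: Rle_trans h _; apply: Rmult_le_compat_l.
    by apply: Rmult_le_pos => //; exact: pow2_ge_0.
  apply: Rmult_le_compat; last 1 first.
  - by apply: pow_incr; lra.
  - suff : 0 <= eta * (M * snorm X) by lra.
    apply: Rmult_le_pos => //; apply: Rmult_le_pos => //.
    exact: is_svals_ge0 (singvalP X).
  - exact: pow2_ge_0.
  - lra.
have : 0 <= eta * frob H ^ 2 by apply: Rmult_le_pos => //; exact: pow2_ge_0.
rewrite -/G -/H => hh0 hM; have := Rmult_le_compat_r _ _ _ hh0 eG; lra.
Qed.

(** Adding strong convexity in both directions between [V V^T] and 0 gives [m |Y|^2 <= <gradf Y -
    gradf 0, Y> <= M |Y|^2]. *)
Lemma strongly_convex_le_smooth n r (f : 'M[R]_n -> R) gradf M m (V : 'M[R]_(n, r)) :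
  smooth gradf M -> restricted_strongly_convex f gradf m r ->
  0 < frob (V *m V^T) -> m <= M.
Proof.
move=> sm sc V0; set Y := V *m V^T in V0.
have pY : is_psd Y by exact: psd_gram.
have rY : rank_le Y r by exact: rank_le_gram.
have e0 : (0%R : 'M[R]_n) = (0%R : 'M[R]_(n, r)) *m (0%R : 'M[R]_(n, r))^T by rewrite mul0mx.
have p0 : is_psd (0%R : 'M[R]_n) by rewrite e0; exact: psd_gram.
have r0 : rank_le (0%R : 'M[R]_n) r by rewrite e0; exact: rank_le_gram.
have := sc _ _ pY p0 rY r0; have := sc _ _ p0 pY r0 rY.
have := sm _ _ pY p0; rewrite !msubE subr0 sub0r frobN minnerNr => gl s1 s2.
have := minner_le (gradf Y - gradf 0)%R Y; rewrite minnerDl minnerNl => gi.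
have := Rmult_le_compat_r _ _ _ (Rlt_le _ _ V0) gl.
have : 0 < frob Y ^ 2 by nra.
by nra.
Qed.

(** * The perturbation bounds and the contraction *)

Lemma gram_sub n r (W V : 'M[R]_(n, r)) : let D := (W - V)%R in
  (W *m W^T - V *m V^T = (V *m D^T + D *m V^T) + D *m D^T)%R.
Proof.
move=> D; have -> : W = (V + D)%R by rewrite /D addrC subrK.
have -> : (V + D)^T%R = (V^T + D^T)%R by rewrite linearD.
by rewrite mulmxDl !mulmxDr addrC !addrA addNr add0r.
Qed.

Lemma gram_rot n r (V : 'M[R]_(n, r)) (Q : 'M[R]_r) :
  Q^T *m Q = (1%:M)%R -> (V *m Q) *m (V *m Q)^T = V *m V^T.
Proof. by move=> /mulmx1C oQ; rewrite trmx_mul mulmxA -(mulmxA V) oQ mulmx1. Qed.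

Section GramPerturbation.
Variables (n r : nat) (W V : 'M[R]_(n, r)) (Q : 'M[R]_r).
Hypothesis oQ : Q^T *m Q = (1%:M)%R.
Let D := (W - V *m Q)%R.

Lemma frob_gram_sub_le :
  frob (W *m W^T - V *m V^T)%R <= 2 * snorm V * frob D + frob D ^ 2.
Proof.
rewrite -(gram_rot V oQ) gram_sub -/D.
apply: Rle_trans (frobD _ _) _; apply: Rplus_le_compat; last first.
  by rewrite /= Rmult_1_r -{2}(frob_tr D); exact: frob_mul.
have h : frob (V *m Q *m D^T) <= snorm V * frob D.
  rewrite -mulmxA; apply: Rle_trans (frob_mul_snorm _ _) _.
  by rewrite frob_orthl // frob_tr; exact: Rle_refl.
have h' : frob (D *m (V *m Q)^T) <= snorm V * frob D.
  by rewrite -frob_tr trmx_mul trmxK.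
apply: Rle_trans (frobD _ _) _.
by apply: Rle_trans (Rplus_le_compat _ _ _ _ h h') _; lra.
Qed.

(* With [W^T V Q] symmetric, the cross term [<Z D^T, D Z^T> = |D^T Z|^2] of
   [Z = V Q] is nonnegative. *)
Lemma frob_gram_sub_ge :
  (W^T *m (V *m Q))^T = W^T *m (V *m Q) ->
  frob D <= / 100 * singval V r ->
  139 / 100 * singval V r * frob D <= frob (W *m W^T - V *m V^T)%R.
Proof.
move=> sym Dsmall; set Z := V *m Q in sym *.
set T := (Z *m D^T + D *m Z^T)%R.
have s0 : 0 <= singval V r by exact: is_svals_ge0 (singvalP V).
have d0 := frob_ge0 D.
have symD : (D^T *m Z)^T = D^T *m Z.
  have -> : D^T *m Z = (W^T *m Z - Z^T *m Z)%R by rewrite -mulmxBl /D linearB.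
  by rewrite linearB /= sym trmx_mul trmxK.
have hZ : singval V r * frob D <= frob (Z *m D^T).
  rewrite -(frob_tr D) -(@frob_orthl _ _ Q D^T oQ) /Z -mulmxA.
  exact: singval_mul_frob.
have cross : 0 <= minner (Z *m D^T) (D *m Z^T).
  rewrite minner_mull mulmxA -minner_mulr.
  have -> : Z^T *m D = D^T *m Z by rewrite -{1}[D]trmxK -trmx_mul symD.
  exact: minner_ge0.
have hT : 2 * (singval V r * frob D) ^ 2 <= frob T ^ 2.
  have tr : frob (D *m Z^T) = frob (Z *m D^T) by rewrite -frob_tr trmx_mul trmxK.
  have sq := pow_incr _ _ 2 (conj (Rmult_le_pos _ _ s0 d0) hZ).
  have e : frob T ^ 2 = 2 * frob (Z *m D^T) ^ 2 + 2 * minner (Z *m D^T) (D *m Z^T).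
    rewrite frob_sqr /T minnerDl !minnerDr -!frob_sqr tr (minner_sym (D *m Z^T)); ring.
  lra.
(* [1.4^2 < 2]; the term [D D^T] then costs 1/100, leaving 1.39. *)
have T14 : 14 / 10 * (singval V r * frob D) <= frob T.
  by apply: pow2_le_inv; [exact: frob_ge0|have := pow2_ge_0 (singval V r * frob D); nra].
have -> : (W *m W^T - V *m V^T)%R = (T + D *m D^T)%R.
  by rewrite -(gram_rot V oQ) gram_sub.
have := frobB (T + D *m D^T)%R (D *m D^T); rewrite addrK.
have := frob_mul D D^T; rewrite frob_tr.
have : frob D * frob D <= / 100 * (singval V r * frob D) by nra.
lra.
Qed.
End GramPerturbation.

Lemma snorm_ge0 m p (A : 'M[R]_(m, p)) : 0 <= snorm A.
Proof. exact: is_svals_ge0 (singvalP A). Qed.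

Lemma snorm_sub_abs m p (A B : 'M[R]_(m, p)) : Rabs (snorm A - snorm B) <= frob (A - B)%R.
Proof.
have hA := snorm_lip A B; have hB := snorm_lip B A.
have e : frob (B - A)%R = frob (A - B)%R by rewrite -frobN opprB.
by rewrite e in hB; apply: Rabs_le; lra.
Qed.

(** Stated for any [W] in the ball because both [U0] and [U] need it. Origin of the constant:
    [2 |V| |D| + |D|^2 <= 2.01 rho |Xs|] gives 0.0201 after multiplication by [M], and the distance
    from [Xs] to [Xsr] adds 0.005. *)
Lemma iterate_perturbation n r (gradf : 'M[R]_n -> 'M[R]_n) M m rho (Xs Xsr : 'M[R]_n)
    (V W : 'M[R]_(n, r)) (Q : 'M[R]_r) :
  smooth gradf M -> is_psd Xs -> Xsr = V *m V^T -> Q^T *m Q = (1%:M)%R ->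
  0 < m -> m <= M -> 0 <= rho <= / 100 ->
  0 <= singval V r <= snorm V -> snorm V ^ 2 = snorm Xs ->
  M * (rho * snorm Xs) = m * singval V r ^ 2 / 100 ->
  M * frob (Xs - Xsr)%R <= m * singval V r ^ 2 / 200 ->
  frob (W - V *m Q)%R <= rho * singval V r ->
  let X := W *m W^T in
  [/\ frob (gradf X - gradf Xs)%R <= 251 / 10000 * (m * singval V r ^ 2),
      Rabs (M * snorm X - M * snorm Xs) <= 251 / 10000 * (M * snorm Xs) &
      Rabs (snorm (gradf X) - snorm (gradf Xs)) <= 251 / 10000 * (M * snorm Xs)].
Proof.
move=> sm pXs eXsr oQ m0 mM rho01 sr sl rl hE hD X.
have pX : is_psd X by exact: psd_gram.
have M0 : 0 < M by lra.
have d0 := frob_ge0 (W - V *m Q)%R; have e1 := frob_gram_sub_le W V oQ.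
set d := frob (W - V *m Q)%R in d0 e1 hD; set s := singval V r in hD sr hE rl *.
set t := snorm V in e1 sr sl; rewrite -/X -eXsr in e1.
have s2 : s ^ 2 <= snorm Xs by rewrite -sl; apply: pow_incr.
have stl : t * (rho * s) <= rho * snorm Xs.
  rewrite -sl (_ : t * (rho * s) = rho * (t * s)); last ring.
  by apply: Rmult_le_compat_l; [lra|nra].
have rl0 : 0 <= rho * snorm Xs.
  by apply: Rmult_le_pos; [lra|have := pow2_ge_0 s; lra].
have d2 : d ^ 2 <= / 100 * (rho * snorm Xs).
  have : d ^ 2 <= (rho * s) ^ 2 by apply: pow_incr.
  have -> : (rho * s) ^ 2 = rho * (rho * s ^ 2) by ring.
  have : rho * s ^ 2 <= / 100 * snorm Xs by have := pow2_ge_0 s; nra.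
  by nra.
have XXsr : M * frob (X - Xsr)%R <= 201 / 10000 * (m * s ^ 2).
  have td : t * d <= rho * snorm Xs by nra.
  have : M * frob (X - Xsr)%R <= M * (201 / 100 * (rho * snorm Xs)).
    by apply: Rmult_le_compat_l; [lra|apply: Rle_trans e1 _; lra].
  by lra.
have XXs : M * frob (X - Xs)%R <= 251 / 10000 * (m * s ^ 2).
  have -> : (X - Xs)%R = ((X - Xsr) - (Xs - Xsr))%R by rewrite opprB addrA subrK.
  apply: Rle_trans (Rmult_le_compat_l M _ _ (Rlt_le _ _ M0) (frobB _ _)) _.
  by rewrite Rmult_plus_distr_l; apply: Rle_trans (Rplus_le_compat _ _ _ _ XXsr hE) _; lra.
have ms : m * s ^ 2 <= M * snorm Xs.
  by apply: Rmult_le_compat; [lra|exact: pow2_ge_0|lra|lra].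
have grad : frob (gradf X - gradf Xs)%R <= 251 / 10000 * (m * s ^ 2).
  by have := sm _ _ pX pXs; rewrite !msubE => h; exact: Rle_trans h XXs.
split=> //.
- rewrite -Rmult_minus_distr_l Rabs_mult Rabs_pos_eq; last lra.
  apply: Rle_trans (Rmult_le_compat_l M _ _ (Rlt_le _ _ M0) (snorm_sub_abs _ _)) _.
  by apply: Rle_trans XXs _; lra.
- apply: Rle_trans (snorm_sub_abs _ _) _.
  by apply: Rle_trans grad _; lra.
Qed.

Theorem theorem4p2 (n r : nat) (f : 'M[R]_n -> R) (gradf : 'M[R]_n -> 'M[R]_n)
    (M m : R) (Xs Xsr : 'M[R]_n) (Usr U0 U : 'M[R]_(n, r)) :
  (0 < r)%N -> 0 < m ->
  convex_fun f -> has_gradient f gradf -> symmetric_fun f ->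
  smooth gradf M -> restricted_strongly_convex f gradf m r ->
  is_psd Xs -> (forall Y, is_psd Y -> f Xs <= f Y) -> rank_ge Xs r ->
  best_rank_approx Xs r Xsr -> Xsr = mmul Usr (trmx Usr) ->
  let kappa := M / m in
  let rho := / (100 * kappa) * (singval Xs r / singval Xs 1) in
  Dist U0 Usr <= rho * singval Usr r ->
  frob (msub Xs Xsr) <=
    / (200 * (kappa * sqrt kappa)) * (singval Xs r / singval Xs 1) * singval Xs r ->
  let X0 := mmul U0 (trmx U0) in
  let eta := / (16 * (M * snorm X0 + snorm (gradf X0))) in
  Dist U Usr <= rho * singval Usr r ->
  let X := mmul U (trmx U) in
  let Up := msub U (mscale eta (mmul (gradf X) U)) in
  let alpha := 1 - m * singval Xs r / (64 * (M * snorm Xs + snorm (gradf Xs))) in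
  let beta := M / (28 * (M * snorm Xs + snorm (gradf Xs))) in
  Dist Up Usr ^ 2 <= alpha * Dist U Usr ^ 2 + beta * frob (msub Xs Xsr) ^ 2 /\
  Dist Up Usr <= rho * singval Usr r.
Proof.
move=> r0 m0 _ fg fs sm sc pXs minXs rk bra eXsr kappa rho hU0 hE X0 eta hU X Up alpha beta.
have eX0 : X0 = U0 *m U0^T by exact: mmulE.
have eX : X = U *m U^T by exact: mmulE.
have eUp : Up = (U - eta *: (gradf X *m U))%R by rewrite /Up mmulE mscaleE msubE.
rewrite mmulE in eXsr; rewrite msubE in hE *.
have erho : rho = / (100 * kappa) * (singval Xs r / snorm Xs) by [].
have ekappa : kappa = M / m by [].
have eeta : eta = / (16 * (M * snorm X0 + snorm (gradf X0))) by [].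
have ealpha : alpha =
  1 - m * singval Xs r / (64 * (M * snorm Xs + snorm (gradf Xs))) by [].
have ebeta : beta = M / (28 * (M * snorm Xs + snorm (gradf Xs))) by [].
clearbody Up X alpha beta eta X0 rho kappa.
have lr0 : 0 < singval Xs r by exact: rank_ge_singval_gt0.
have lrl1 : singval Xs r <= singval Xs 1 by apply: is_svals_le (singvalP Xs) _; rewrite r0.
have sr2 : singval Usr r ^ 2 = singval Xs r.
  by rewrite -singval_gram -eXsr (best_rank_approx_singval _ bra) leqnn.
have s12 : snorm Usr ^ 2 = snorm Xs.
  by rewrite /snorm -singval_gram -eXsr (best_rank_approx_singval _ bra) r0.
have sr0 : 0 <= singval Usr r by exact: is_svals_ge0 (singvalP Usr).
have srs1 : singval Usr r <= snorm Usr.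
  by apply: is_svals_le (singvalP Usr) _; rewrite r0.
have pXsr : is_psd Xsr by rewrite eXsr; exact: psd_gram.
have mM : m <= M.
  apply: (strongly_convex_le_smooth sm sc (V := Usr)); rewrite -eXsr.
  apply: Rlt_le_trans (snorm_le_frob _).
  rewrite /snorm (best_rank_approx_singval _ bra) r0; lra.
rewrite -/(snorm Xs) in hE lrl1.
set l := singval Xs r in lr0 lrl1 sr2 erho hE ealpha.
set L := snorm Xs in lrl1 s12 erho hE ealpha ebeta.
set s := singval Usr r in sr2 sr0 srs1 hU0 hU *.
have L0 : 0 < L by lra.
have kap1 : 1 <= kappa.
  by apply: (Rmult_le_reg_r m) => //; rewrite ekappa /Rdiv Rmult_assoc Rinv_l; lra.
have rhoE : M * (rho * L) = m * s ^ 2 / 100.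
  by rewrite sr2 erho ekappa; field; repeat split; lra.
have rho0 : 0 < rho.
  rewrite erho; apply: Rmult_lt_0_compat; first by apply: Rinv_0_lt_compat; lra.
  by apply: Rmult_lt_0_compat => //; exact: Rinv_0_lt_compat.
have rho1 : rho <= / 100.
  apply: (Rmult_le_reg_r (M * L)); first nra.
  have -> : rho * (M * L) = M * (rho * L) by ring.
  by rewrite rhoE sr2; nra.
set E := frob (Xs - Xsr)%R in hE *.
have E0 : 0 <= E by exact: frob_ge0.
have sk1 : 1 <= sqrt kappa by rewrite -sqrt_1; apply: sqrt_le_1_alt.
have sk2 : sqrt kappa ^ 2 = kappa by rewrite pow2_sqrt //; lra.
have hE' : E <= rho * l / 2 * / sqrt kappa.
  by apply: Rle_trans hE _; rewrite erho; apply: Req_le; field; repeat split; lra.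
have rl0 : 0 < rho * l by nra.
have isk : 0 < / sqrt kappa <= 1.
  split; first by apply: Rinv_0_lt_compat; lra.
  by rewrite -[X in _ <= X]Rinv_1; apply: Rinv_le_contravar; lra.
have ME : M * E <= m * s ^ 2 / 200.
  have : E <= rho * L / 2 by nra.
  by nra.
(* The factor [1 / sqrt kappa] in [hE'], once squared, turns [M] into [m]. *)
have ME2 : M * E ^ 2 <= m * (rho ^ 2 * l ^ 2) / 4.
  have : E ^ 2 <= (rho * l / 2 * / sqrt kappa) ^ 2 by apply: pow_incr.
  have -> : (rho * l / 2 * / sqrt kappa) ^ 2 = rho ^ 2 * l ^ 2 / 4 * / kappa.
    by rewrite -[in RHS]sk2; field; lra.
  move=> h; have := Rmult_le_compat_l M _ _ ltac:(lra) h.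
  have -> : M * (rho ^ 2 * l ^ 2 / 4 * / kappa) = m * (rho ^ 2 * l ^ 2) / 4; last by [].
  by rewrite ekappa; field; lra.
have pert := fun W Q oQ hW => @iterate_perturbation n r gradf M m rho Xs Xsr Usr W Q sm pXs eXsr oQ
  m0 mM (conj (Rlt_le _ _ rho0) rho1) (conj sr0 srs1) s12 rhoE ME hW.
have [Q0 [oQ0 eQ0 _]] := Dist_attained U0 Usr.
have [Q [oQ eQ symQ]] := Dist_attained U Usr.
rewrite eQ0 in hU0; have [_ b0 c0] := pert _ _ oQ0 hU0; rewrite -eX0 -/L in b0 c0.
have hU' := hU; rewrite eQ in hU'; have [gE b1 c1] := pert _ _ oQ hU'.
rewrite -eX -/L -/s sr2 in gE b1 c1.
set gs := snorm (gradf Xs) in c0 c1 ealpha ebeta.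
have gs0 : 0 <= gs by exact: snorm_ge0.
pose S := M * L + gs; rewrite -/S in ealpha ebeta.
have ML : m * l <= M * L by nra.
have S0 : 0 < S by rewrite /S; nra.
have abs_lb x y : Rabs x <= y -> - y <= x <= y.
  by move: (Rle_abs x) (Rle_abs (- x)); rewrite Rabs_Ropp; lra.
have {}b0 := abs_lb _ _ b0; have {}c0 := abs_lb _ _ c0.
have {}b1 := abs_lb _ _ b1; have {}c1 := abs_lb _ _ c1.
pose S' := M * snorm X0 + snorm (gradf X0); rewrite -/S' in eeta.
(* Each of the two terms is off by at most 0.0251 [M * L]; 6 percent in total is enough to place
   [eta * S] between 1/17 and 1/15. *)
have S'b : 94 / 100 * S <= S' <= 106 / 100 * S by rewrite /S' /S; lra.
have etaS : eta * S' = / 16 by rewrite eeta; field; lra.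
have eta0 : 0 < eta by rewrite eeta; apply: Rinv_0_lt_compat; lra.
have etaSl : / 17 <= eta * S by nra.
have etaSu : eta * S <= / 15 by nra.
have [||||Y [pY decr]] := gradient_step_decrease (eta := eta) (U := U) fg fs sm; try lra.
- rewrite -eX; have : eta * snorm (gradf X) <= eta * (106 / 100 * S).
    by apply: Rmult_le_compat_l; [lra|rewrite /S; have := snorm_ge0 Xs; nra].
  lra.
- rewrite -eX; have : eta * (M * snorm X) <= eta * (106 / 100 * S).
    by apply: Rmult_le_compat_l; [lra|rewrite /S; nra].
  lra.
rewrite -eX in decr; set G := gradf X in decr gE eUp c1.
set H := G *m U in decr eUp; pose D := (U - Usr *m Q)%R.
set d := Dist U Usr in eQ hU *.
have d0 : 0 <= d by rewrite eQ; exact: frob_ge0.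
have pX : is_psd X by rewrite eX; exact: psd_gram.
have sG : G^T = G by apply: gradient_tr fg fs (psd_tr pX).
have minY := minXs _ pY.
have fXsr : f Xsr <= f Xs + M / 2 * E ^ 2.
  apply: Rle_trans (smooth_upper fg sm pXs pXsr) _.
  have -> : (Xsr - Xs)%R = (- (Xs - Xsr))%R by rewrite opprB.
  have := gradient_psd_ge0 fg pXs minXs (best_rank_approx_residual_psd bra).
  by rewrite frobN minnerNr -/E; lra.
pose DX := (X - Xsr)%R.
have scX : f Xsr >= f X - minner G DX + m / 2 * frob DX ^ 2.
  have rX : rank_le X r by rewrite eX; exact: rank_le_gram.
  have rXsr : rank_le Xsr r by rewrite eXsr; exact: rank_le_gram.
  have := sc _ _ pX pXsr rX rXsr; rewrite msubE.
  by rewrite -(opprB X Xsr) minnerNr frobN.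
pose DD := D *m D^T.
have GDD : - (251 / 10000 * (m * l)) * d ^ 2 <= minner G DD.
  have := gradient_psd_ge0 fg pXs minXs (psd_gram D).
  have := minner_ge (G - gradf Xs)%R (D *m D^T); rewrite minnerDl minnerNl.
  have nDD : frob (D *m D^T) <= d ^ 2.
    by rewrite /= Rmult_1_r {2}eQ -/D -(frob_tr D) eQ; exact: frob_mul.
  have := Rmult_le_compat _ _ _ _ (frob_ge0 _) (frob_ge0 _) gE nDD.
  move=> h1 h2 h3; rewrite Ropp_mult_distr_l_reverse.
  apply: Rle_trans (Rle_trans _ _ _ (Ropp_le_contravar _ _ h1) h2) _.
  rewrite -[X in _ <= X]Rplus_0_r; apply: Rplus_le_compat_l.
  by rewrite -Ropp_0; exact: Ropp_le_contravar.
(* [D U^T + U D^T = DX + DD], and symmetry of [G] gives both left-hand summands the same pairing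
   with [G]. *)
have cross : 2 * minner D H = minner G DX + minner G DD.
  have -> : 2 * minner D H = minner G (D *m U^T) + minner G (U *m D^T).
    have -> : minner G (U *m D^T) = minner G (D *m U^T).
      by rewrite -minner_tr sG trmx_mul trmxK.
    by rewrite [minner G _]minner_sym minner_mulr trmxK -/H; ring.
  rewrite -!minnerDr; congr minner.
  rewrite /DX eX eXsr -(gram_rot Usr oQ) /DD /D; move: (Usr *m Q) => Z.
  have -> : (U - Z)^T%R = (U^T - Z^T)%R by rewrite linearB.
  rewrite !mulmxBl !mulmxBr.
  move: (U *m U^T) (Z *m U^T) (U *m Z^T) (Z *m Z^T) => a b c e.
  by rewrite opprB [in RHS](addrC (a - c)%R) [RHS]addrA [in RHS](addrA (a - e)%R) subrK.
(* [1.39^2 / 2 > 0.96]; after the loss 0.0251 in [GDD], 0.93 still leaves the 0.90 of [gain]. *)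
have lower : 93 / 100 * (m * l * d ^ 2) <= m / 2 * frob DX ^ 2.
  have Dsm : frob (U - Usr *m Q)%R <= / 100 * singval Usr r.
    by rewrite -eQ -/s; nra.
  have := frob_gram_sub_ge oQ symQ Dsm; rewrite -eX -eXsr -eQ -/s => h.
  have sd0 : 0 <= 139 / 100 * s * d by nra.
  have := pow_incr _ _ 2 (conj sd0 h); rewrite !Rpow_mult_distr sr2 => h2.
  apply: Rle_trans (Rmult_le_compat_l (m / 2) _ _ _ h2); last lra.
  have : 0 <= m * l * d ^ 2; last lra.
  by apply: Rmult_le_pos; [nra|exact: pow2_ge_0].
(* The rotation [Q] optimal for [U] is kept; for [Up] it gives an upper bound on the distance. *)
have step : Dist Up Usr ^ 2 <= d ^ 2 - 2 * eta * minner D H + eta ^ 2 * frob H ^ 2.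
  have le : Dist Up Usr <= frob (D - eta *: H)%R.
    by rewrite /D addrAC -eUp; exact: Dist_le.
  have D0 : 0 <= Dist Up Usr.
    by have [? [_ -> _]] := Dist_attained Up Usr; exact: frob_ge0.
  apply: Rle_trans (pow_incr _ _ 2 (conj D0 le)) _.
  rewrite frobB_sqr minnerZr frobZ; last lra.
  by rewrite -eQ; apply: Req_le; ring.
have fin : Dist Up Usr ^ 2 <= alpha * d ^ 2 + beta * E ^ 2.
  have mld : 0 <= m * l * d ^ 2 by apply: Rmult_le_pos; [nra|exact: pow2_ge_0].
  (* The descent surplus [eta |H|^2], multiplied by [eta], cancels exactly the quadratic term in
     [step]. *)
  have gain : 90 / 100 * (m * l * d ^ 2) - M / 2 * E ^ 2 + eta * frob H ^ 2 <= 2 * minner D H.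
    by rewrite cross; lra.
  have {gain} := Rmult_le_compat_l eta _ _ (Rlt_le _ _ eta0) gain => gain.
  apply: Rle_trans step _; rewrite ealpha ebeta.
  apply: Rle_trans (_ : d ^ 2 - eta * (90 / 100 * (m * l * d ^ 2)) + eta * (M / 2 * E ^ 2) <= _).
    by lra.
  have ME0 : 0 <= M * E ^ 2 by apply: Rmult_le_pos; [lra|exact: pow2_ge_0].
  (* The stated constants follow from [0.9 / 17 > 1 / 64] and [1 / (2 * 15) < 1 / 28]. *)
  have e1 : / S * / 17 <= eta.
    by apply: (Rmult_le_reg_r S) => //; rewrite (_ : / S * / 17 * S = / 17) //; field; lra.
  have e2 : eta <= / S * / 15.
    by apply: (Rmult_le_reg_r S) => //; rewrite (_ : / S * / 15 * S = / 15) //; field; lra.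
  have -> : (1 - m * l / (64 * S)) * d ^ 2 + M / (28 * S) * E ^ 2 =
      d ^ 2 - / S * / 64 * (m * l * d ^ 2) + / S * / 28 * (M * E ^ 2) by field; lra.
  have iS : 0 < / S by exact: Rinv_0_lt_compat.
  have := Rmult_le_compat_r _ _ _ mld e1; have := Rmult_le_compat_r _ _ _ ME0 e2.
  have : 0 <= / S * (m * l * d ^ 2) by nra.
  have : 0 <= / S * (M * E ^ 2) by nra.
  lra.
split; first exact: fin.
apply: pow2_le_inv; first nra.
apply: Rle_trans fin _; rewrite Rpow_mult_distr sr2.
have d2 : d ^ 2 <= rho ^ 2 * l.
  by rewrite -sr2 -Rpow_mult_distr; apply: pow_incr.
have alpha0 : 0 <= alpha.
  rewrite ealpha; have : m * l / (64 * S) <= 1; last lra.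
  have mlS : m * l <= S by rewrite /S; lra.
  apply: (Rmult_le_reg_r (64 * S)); first lra.
  have -> : m * l / (64 * S) * (64 * S) = m * l by field; lra.
  lra.
have := Rmult_le_compat_l _ _ _ alpha0 d2.
(* In units of [m rho^2 l^2 / S], the left side is at most 1/112 by [ME2] and the right side is
   1/64. *)
suff : beta * E ^ 2 <= (1 - alpha) * (rho ^ 2 * l) by lra.
have -> : beta * E ^ 2 = / S * / 28 * (M * E ^ 2) by rewrite ebeta; field; lra.
have -> : (1 - alpha) * (rho ^ 2 * l) = / S * / 64 * (m * (rho ^ 2 * l ^ 2)).
  by rewrite ealpha; field; lra.
have iS : 0 < / S by exact: Rinv_0_lt_compat.
have := Rmult_le_compat_l _ _ _ (Rlt_le _ _ iS) ME2.
have : 0 <= / S * (m * (rho ^ 2 * l ^ 2)).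
  by apply: Rmult_le_pos; [lra|apply: Rmult_le_pos; [lra|nra]].
lra.
Qed.
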